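(* In the team-design model described in the context with baseline covariance kernel $C_0$, suppose $f$ is convex (with $0<f'(1)<1/2$) and fix $\rho\in(0,\bar\rho)$. For each $i$, let $k_i^*(t)$ denote the optimal team size when the covariance kernel is $$C_{i,t}(x,x')=C_0(x,x')+t\,\phi_i(x)\phi_i(x'),$$ for $t$ in a neighborhood of $0$ with $\lambda_i+t\ge0$. Then there exists a cutoff $\bar\lambda$ such that, for every $i$, $$\frac{dk_i^*(t)}{dt}\Big|_{t=0}>0\ \text{ if }\lambda_i<\bar\lambda,\qquad \frac{dk_i^*(t)}{dt}\Big|_{t=0}<0\ \text{ if }\lambda_i>\bar\lambda,$$ and the derivative is zero if $\lambda_i=\bar\lambda$.
   Context: Model. For a symmetric, continuous, positive definite covariance kernel $C$ on $[0,1]^2$ with $\int_0^1C(x,x)dx<\infty$, let $\lambda_1\ge\lambda_2\ge\dots>0$ be the strictly positive eigenvalues (with multiplicity) of its covariance operator, with orthonormal eigenfunctions $\phi_i$; infinitely many eigenvalues are assumed strictly positive. For the baseline kernel $C_0$ these are $(\lambda_i,\phi_i)_{i\ge1}$. Under $C_{i,t}$ the eigenvalue attached to $\phi_i$ is $\lambda_i+t$ and all other eigenvalue–eigenfunction pairs are unchanged. The function $f:[1,\infty)\to\mathbb R$ is strictly increasing and smooth, with $f(1)=1$ and $\lim_{k\to\infty}f(k)=\infty$. Given attention capacity $\rho>0$, the water level $\mu^*>0$ is the unique number with $\frac12\sum_i\max\{0,\log(\lambda_i/\mu^* )\}=\rho$, and $n=\#\{i:\lambda_i>\mu^*\}$.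 The organization's total loss (coordination loss under the optimal signal of mutual information at most $\rho$ about the team-state process $W_1(u)=W_0(ku)/2$ on $[0,1/k]$, where $W_0$ is the mean-zero Gaussian process with kernel $C$, plus adaptation loss) from team size $k$ is $$L(k)=\frac1{4k}\Big(n\mu^*+\sum_{i=n+1}^\infty\lambda_i\Big)+\frac{f(k)}2\sum_{i=1}^\infty\lambda_i ,$$ and the optimal team size is the minimizer of $L$ over $k\in[1,\infty)$. The threshold $\bar\rho$ is the value of $\rho$, for the kernel $C_0$, at which $\frac{n\mu^*+\sum_{i>n}\lambda_i}{\sum_{i}\lambda_i}=2f'(1)$; for $f$ convex with $0<f'(1)<1/2$, the optimal team size exceeds $1$ exactly when $\rho<\bar\rho$. *)

(* Defs.v *)
(* Stdlib reals with Coquelicot. Sequences are indexed from 0: lam 0 is the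
   largest eigenvalue. *)
From Stdlib Require Import Reals List.
From Coquelicot Require Import Coquelicot.
Open Scope R_scope.

Definition unit_interval (x : R) : Prop := 0 <= x <= 1.

Definition unit_square (p : R * R) : Prop :=
  unit_interval (fst p) /\ unit_interval (snd p).

(* Positive definiteness of a covariance kernel: every Gram matrix is positive
   semidefinite. Strictness is not required, since covariance operators may
   have a kernel. *)
Definition positive_definite (C : R -> R -> R) : Prop :=
  forall (m : nat) (x a : nat -> R),
    (forall i, (i <= m)%nat -> unit_interval (x i)) ->
    0 <= sum_n (fun i => sum_n (fun j => a i * a j * C (x i) (x j)) m) m.

Record covariance_kernel (C : R -> R -> R) : Prop := {
  kernel_symmetric : forall x y, unit_interval x -> unit_interval y ->
    C x y = C y x;
  kernel_continuous :
    continuous_on unit_square (fun p : R * R => C (fst p) (snd p));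
  kernel_positive_definite : positive_definite C;
  kernel_trace : ex_RInt (fun x => C x x) 0 1
}.

Definition inner (u v : R -> R) : R := RInt (fun x => u x * v x) 0 1.

Definition covariance_operator (C : R -> R -> R) (psi : R -> R) (x : R) : R :=
  RInt (fun y => C x y * psi y) 0 1.

(* For a continuous kernel, every square-integrable eigenfunction with nonzero
   eigenvalue has a unique continuous representative, so that eigenfunctions
   for positive eigenvalues are taken to be continuous on [0,1]. *)
Record eigenpair (C : R -> R -> R) (l : R) (psi : R -> R) : Prop := {
  eigenfunction_continuous : continuous_on unit_interval psi;
  eigenfunction_nonzero : exists x, unit_interval x /\ psi x <> 0;
  eigenfunction_equation : forall x, unit_interval x ->
    covariance_operator C psi x = l * psi x
}.

(* lam lists all the positive eigenvalues of the covariance operator of C in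
   nonincreasing order and with multiplicity, phi being associated orthonormal
   eigenfunctions. By [spectrum_complete], the phi i with lam i = l span the
   eigenspace of each l > 0. That lam is an infinite sequence encodes the
   assumption of infinitely many positive eigenvalues. *)
Record positive_spectrum (C : R -> R -> R) (lam : nat -> R)
    (phi : nat -> R -> R) : Prop := {
  spectrum_positive : forall i, 0 < lam i;
  spectrum_nonincreasing : forall i, lam (S i) <= lam i;
  spectrum_eigenpair : forall i, eigenpair C (lam i) (phi i);
  spectrum_orthonormal : forall i j,
    inner (phi i) (phi j) = if Nat.eqb i j then 1 else 0;
  spectrum_complete : forall l psi, 0 < l -> eigenpair C l psi ->
    exists i, inner psi (phi i) <> 0
}.

Definition perturbed_kernel (C : R -> R -> R) (phi : R -> R) (t : R)
    : R -> R -> R :=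
  fun x x' => C x x' + t * phi x * phi x'.

Definition team_sizes (k : R) : Prop := 1 <= k.

(* Derivatives are taken relative to [1,+oo), hence one-sided at 1. *)
Definition smooth_on (D : R -> Prop) (f : R -> R) : Prop :=
  exists F : nat -> R -> R,
    (forall x, D x -> F 0%nat x = f x) /\
    (forall n x, D x -> D_in (F n) (F (S n)) D x).

Definition convex_on (D : R -> Prop) (f : R -> R) : Prop :=
  forall x y s, D x -> D y -> 0 <= s <= 1 ->
    f (s * x + (1 - s) * y) <= s * f x + (1 - s) * f y.

Record adaptation_function (f : R -> R) : Prop := {
  adaptation_increasing : forall x y, team_sizes x -> team_sizes y ->
    x < y -> f x < f y;
  adaptation_smooth : smooth_on team_sizes f;
  adaptation_one : f 1 = 1;
  adaptation_unbounded : is_lim f p_infty p_infty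
}.

Definition water_level (lam : nat -> R) (rho mu : R) : Prop :=
  0 < mu /\ is_series (fun i => / 2 * Rmax 0 (ln (lam i / mu))) rho.

(* n is the number of indices i with lam i > mu. *)
Definition active_count (lam : nat -> R) (mu : R) (n : nat) : Prop :=
  exists s : list nat,
    NoDup s /\ length s = n /\ forall i, In i s <-> mu < lam i.

Definition residual_variance (lam : nat -> R) (mu : R) (n : nat) : R :=
  INR n * mu + Series (fun j => lam (n + j)%nat).

Definition total_loss (lam : nat -> R) (mu : R) (n : nat) (f : R -> R)
    (k : R) : R :=
  / (4 * k) * residual_variance lam mu n + f k / 2 * Series lam.

Definition optimal_team_size (C : R -> R -> R) (f : R -> R) (rho k : R)
    : Prop :=
  exists (lam : nat -> R) (phi : nat -> R -> R) (mu : R) (n : nat),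
    positive_spectrum C lam phi /\
    water_level lam rho mu /\
    active_count lam mu n /\
    team_sizes k /\
    forall k', team_sizes k' ->
      total_loss lam mu n f k <= total_loss lam mu n f k'.

(* d stands for the derivative f'(1). *)
Definition capacity_threshold (lam : nat -> R) (d rhobar : R) : Prop :=
  0 < rhobar /\
  exists (mu : R) (n : nat),
    water_level lam rhobar mu /\
    active_count lam mu n /\
    residual_variance lam mu n / Series lam = 2 * d.

(* Main.v *)
(* A perturbation along phi i leaves the eigenfunctions unchanged, and any two
   complete orthonormal systems of eigenfunctions of one kernel give the same
   sums of g(eigenvalue) for g >= 0, so the loss under C_{i,t} may be computed
   from the eigenvalues lam with lam i + t in place of lam i.

   The residual variance is V = sum_j min(mu, lam j), the value of a convex
   program whose Lagrangian depends on lam i through a concave function with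
   derivative min(1, mu / lam i). Comparing the programs at t and at 0 through
   each other's multipliers sandwiches V(t) - V(0), hence
   V'(0) = min(1, mu / lam i), also in the borderline case lam i = mu.

   For rho < rhobar the optimum is interior: 2 k^2 f'(k) = V / S with
   S = sum_j lam j. The left-hand side has positive derivative in k, so dk/dt
   has the sign of (V / S)' = (min(1, mu / lam i) - V / S) / S. Since V / S < 1,
   this sign changes at lambdabar = mu S / V. *)
Require Import Defs.
From Stdlib Require Import Reals List Lra Lia.
From Coquelicot Require Import Coquelicot.
Open Scope R_scope.

(** * Iterated integrals of continuous functions *)

(** An optimum comes with some sorted spectrum of the perturbed kernel, unrelated at first to [lam]
    and [phi]: a shifted eigenvalue can overtake its neighbours, and a multiple eigenvalue leaves
    its eigenfunctions undetermined. Hence everything is reduced to order-free sums and evaluated on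
    the unsorted list [shift_at lam i t].

    The number of active components can jump at t = 0, so V is not differentiated through its
    formula. The two slopes of the sandwich still contain the perturbed level and the perturbed
    eigenvalue; a Lipschitz bound on the logarithm of the water level puts both within O(|t|) of
    min(1, mu / lam i), which leaves an error O(t^2).

    [kstar i] is a mere selection of minimizers, and its continuity at 0 has to be proved. In place
    of an implicit function theorem, convexity gives 4 f'(1) |k - k'| <= |G(k) - G(k')| for G(k) = 2
    k^2 f'(k), so that [kstar i] inherits a Lipschitz bound at 0 from V / S. *)

Lemma continuity_2d_pt_section (F : R -> R -> R) (x y : R) :
  continuity_2d_pt F x y -> continuous (F x) y.
Proof.
  intros H. apply continuity_pt_filterlim. intros eps He.
  destruct (H (mkposreal eps He)) as [d Hd]. exists d.
  split; [apply cond_pos|]. intros v [_ Hv]. apply Hd; [|exact Hv].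
  rewrite Rminus_diag, Rabs_R0; apply cond_pos.
Qed.

Lemma continuous_RInt_param (F : R -> R -> R) (a b x : R) :
  (forall u v, continuity_2d_pt F u v) ->
  continuous (fun u => RInt (F u) a b) x.
Proof.
  intros HF.
  assert (Hex : forall u c d, ex_RInt (F u) c d).
  { intros u c d. apply (ex_RInt_continuous (V := R_CompleteNormedModule)).
    intros z _. apply continuity_2d_pt_section, HF. }
  assert (Hle : forall c d, c <= d -> continuous (fun u => RInt (F u) c d) x).
  { intros c d Hcd. apply continuity_pt_filterlim. intros eps He.
    (* The added 1 covers [c = d] and makes the final bound by [eps] strict. *)
    assert (He' : 0 < eps / (d - c + 1)) by (apply Rdiv_lt_0_compat; lra).
    destruct (uniform_continuity_2d F (x - 1) (x + 1) c d
      (fun u v _ _ => HF u v) (mkposreal _ He')) as [del Hdel].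
    exists (Rmin del 1). split.
    { apply Rmin_pos; [apply cond_pos|lra]. }
    intros u [_ Hu]. simpl in Hu. unfold Rdist in Hu. simpl. unfold Rdist.
    assert (Hu1 : Rabs (u - x) < del) by (eapply Rlt_le_trans; [exact Hu|apply Rmin_l]).
    assert (Hu2 : Rabs (u - x) < 1) by (eapply Rlt_le_trans; [exact Hu|apply Rmin_r]).
    apply Rabs_lt_between in Hu2.
    replace (RInt (F u) c d - RInt (F x) c d)
      with (RInt (fun v => F u v - F x v) c d)
      by (apply (RInt_minus (V := R_CompleteNormedModule)); apply Hex).
    apply Rle_lt_trans with ((d - c) * (eps / (d - c + 1))).
    - apply abs_RInt_le_const; [exact Hcd| |].
      + apply (ex_RInt_minus (V := R_NormedModule)); apply Hex.
      + intros v Hv. left. apply (Hdel x v u v); try lra.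
        rewrite Rminus_diag, Rabs_R0; apply cond_pos.
    - apply Rlt_le_trans with ((d - c + 1) * (eps / (d - c + 1))).
      + apply Rmult_lt_compat_r; lra.
      + right; field; lra. }
  destruct (Rle_dec a b) as [Hab|Hab]; [now apply Hle|].
  apply continuous_ext with (fun u => - RInt (F u) b a).
  { intros u. apply (opp_RInt_swap (V := R_CompleteNormedModule)). apply Hex. }
  apply (continuous_opp (V := R_NormedModule)). apply Hle; lra.
Qed.

Lemma continuity_2d_pt_swap (F : R -> R -> R) (x y : R) :
  continuity_2d_pt F x y -> continuity_2d_pt (fun u v => F v u) y x.
Proof.
  intros H eps. destruct (H eps) as [d Hd]. exists d.
  intros u v Hu Hv. now apply Hd.
Qed.

(* Both iterated integrals over [a,s] x [c,d] vanish at [s = a] and have the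
   same derivative in [s]. *)
Lemma RInt_Fubini (F : R -> R -> R) (a b c d : R) :
  a < b -> (forall u v, continuity_2d_pt F u v) ->
  RInt (fun x => RInt (F x) c d) a b =
  RInt (fun y => RInt (fun x => F x y) a b) c d.
Proof.
  intros Hab HF.
  assert (HF' : forall u v, continuity_2d_pt (fun x y => F y x) u v)
    by (intros; now apply continuity_2d_pt_swap).
  pose (H1 := fun s => RInt (fun x => RInt (F x) c d) a s).
  pose (H2 := fun s => RInt (fun y => RInt (fun x => F x y) a s) c d).
  assert (D0 : forall y s, is_derive (fun z => RInt (fun x => F x y) a z) s (F s y)).
  { intros y s. apply (is_derive_RInt (V := R_NormedModule) (fun x => F x y)) with a.
    - apply filter_forall. intros z.
      apply (RInt_correct (V := R_CompleteNormedModule)).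
      apply (ex_RInt_continuous (V := R_CompleteNormedModule)). intros w _.
      apply (continuity_2d_pt_section (fun x y => F y x)), HF'.
    - apply (continuity_2d_pt_section (fun x y => F y x)), HF'. }
  assert (D1 : forall s, is_derive H1 s (RInt (F s) c d)).
  { intros s. apply (is_derive_RInt (V := R_NormedModule) (fun x => RInt (F x) c d)) with a.
    - apply filter_forall. intros z.
      apply (RInt_correct (V := R_CompleteNormedModule)).
      apply (ex_RInt_continuous (V := R_CompleteNormedModule)). intros w _.
      now apply continuous_RInt_param.
    - now apply continuous_RInt_param. }
  assert (D2 : forall s, is_derive H2 s (RInt (F s) c d)).
  { intros s.
    assert (E : forall u y, Derive (fun z => RInt (fun x => F x y) a z) u = F u y).
    { intros u y. apply is_derive_unique, D0. }
    replace (RInt (F s) c d)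
      with (RInt (fun y => Derive (fun z => RInt (fun x => F x y) a z) s) c d)
      by (apply RInt_ext; intros; apply E).
    apply (is_derive_RInt_param (fun z y => RInt (fun x => F x y) a z)).
    - apply filter_forall. intros z y _. eexists. apply D0.
    - intros y _. apply continuity_2d_pt_ext with F; [|apply HF].
      intros; symmetry; apply E.
    - apply filter_forall. intros z.
      apply (ex_RInt_continuous (V := R_CompleteNormedModule)). intros w _.
      now apply (continuous_RInt_param (fun y x => F x y)). }
  assert (D : forall s, a <= s <= b -> is_derive (fun s => H1 s - H2 s) s zero).
  { intros s _.
    pose proof (is_derive_minus (V := R_NormedModule) H1 H2 s _ _ (D1 s) (D2 s)) as D.
    now rewrite minus_eq_zero in D. }
  pose proof (eq_is_derive (V := R_NormedModule) _ a b D Hab) as E. simpl in E.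
  assert (Ha : H1 a = 0) by (apply (RInt_point (V := R_CompleteNormedModule))).
  assert (Ha' : H2 a = 0).
  { unfold H2. rewrite (RInt_ext _ (fun _ => 0)).
    - rewrite RInt_const. apply Rmult_0_r.
    - intros y _. apply (RInt_point (V := R_CompleteNormedModule)). }
  fold (H1 b) (H2 b). lra.
Qed.

(** A retraction of the line onto [0,1]. Kernels and eigenfunctions are continuous only relative to
    the unit interval; composed with [clamp] they become continuous everywhere and keep their values
    there. *)
Definition clamp (x : R) : R := Rmax 0 (Rmin 1 x).

Lemma clamp_unit (x : R) : unit_interval (clamp x).
Proof.
  unfold clamp, unit_interval, Rmax, Rmin.
  destruct (Rle_dec 1 x); destruct (Rle_dec _ _); lra.
Qed.

Lemma clamp_id (x : R) : unit_interval x -> clamp x = x.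
Proof.
  unfold clamp, unit_interval. intros H. now rewrite Rmin_right, Rmax_right.
Qed.

Lemma clamp_lipschitz (x y : R) : Rabs (clamp y - clamp x) <= Rabs (y - x).
Proof.
  unfold clamp, Rmax, Rmin.
  destruct (Rle_dec 1 x); destruct (Rle_dec 1 y); repeat destruct (Rle_dec _ _);
    unfold Rabs; repeat destruct (Rcase_abs _); lra.
Qed.

Lemma continuous_clamp (x : R) : continuous clamp x.
Proof.
  apply continuity_pt_filterlim. intros eps He. exists eps. split; [exact He|].
  intros y [_ Hy]. eapply Rle_lt_trans; [apply clamp_lipschitz|exact Hy].
Qed.

Lemma continuous_on_retract {T U : UniformSpace} (D : T -> Prop) (f : T -> U)
    (r : T -> T) (x : T) :
  continuous_on D f -> (forall y, D (r y)) -> continuous r x ->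
  continuous (fun y => f (r y)) x.
Proof.
  intros Hf HD Hr. unfold continuous.
  apply filterlim_comp with (within D (locally (r x))); [|apply Hf, HD].
  intros P HP. specialize (Hr _ HP). unfold filtermap in *.
  revert Hr. apply filter_imp. intros y Hy. apply Hy, HD.
Qed.

Lemma continuous_clamped (u : R -> R) (x : R) :
  continuous_on unit_interval u -> continuous (fun y => u (clamp y)) x.
Proof.
  intros Hu. apply (continuous_on_retract unit_interval); auto using clamp_unit.
  apply continuous_clamp.
Qed.

Lemma continuous_clamped_2 (C : R -> R -> R) (p : R * R) :
  continuous_on unit_square (fun p : R * R => C (fst p) (snd p)) ->
  continuous (fun q : R * R => C (clamp (fst q)) (clamp (snd q))) p.
Proof.
  intros HC.
  apply (continuous_on_retract (T := prod_UniformSpace R_UniformSpace R_UniformSpace)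
    unit_square (fun p : R * R => C (fst p) (snd p))
    (fun q => (clamp (fst q), clamp (snd q)))); auto.
  - intros q. split; apply clamp_unit.
  - destruct p as [x y].
    apply (continuous_comp_2 (fun q : R * R => clamp (fst q)) (fun q => clamp (snd q)) pair).
    + apply continuous_comp; [apply continuous_fst|apply continuous_clamp].
    + apply continuous_comp; [apply continuous_snd|apply continuous_clamp].
    + apply continuous_ext with (fun z => z); [now intros []|apply continuous_id].
Qed.

(** * Spectra of covariance kernels *)

(* Coquelicot's sums are often typed in a structure projecting to R, which ring
   does not recognize. *)
Ltac ring_R := match goal with |- @eq _ ?a ?b => change (@eq R a b) end; ring.

Lemma continuous_on_plus (D : R -> Prop) (u v : R -> R) :
  continuous_on D u -> continuous_on D v -> continuous_on D (fun x => u x + v x).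
Proof.
  intros Hu Hv x Hx.
  exact (filterlim_comp_2 _ _ _ (Hu x Hx) (Hv x Hx)
    (filterlim_plus (V := R_NormedModule) (u x) (v x))).
Qed.

Lemma continuous_on_mult (D : R -> Prop) (u v : R -> R) :
  continuous_on D u -> continuous_on D v -> continuous_on D (fun x => u x * v x).
Proof.
  intros Hu Hv x Hx.
  exact (filterlim_comp_2 _ _ _ (Hu x Hx) (Hv x Hx)
    (filterlim_mult (K := R_AbsRing) (u x) (v x))).
Qed.

Lemma continuous_on_const (D : R -> Prop) (c : R) : continuous_on D (fun _ => c).
Proof. intros x _. apply filterlim_const. Qed.

Lemma continuous_on_section (C : R -> R -> R) (x : R) :
  continuous_on unit_square (fun p : R * R => C (fst p) (snd p)) ->
  unit_interval x -> continuous_on unit_interval (C x).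
Proof.
  intros HC Hx y Hy.
  pose proof (HC (x, y) (conj Hx Hy)) as H. simpl in H.
  intros P HP. destruct (H P HP) as [d Hd]. exists d.
  intros z Hz Hz'. apply (Hd (x, z)).
  - split; [apply ball_center|exact Hz].
  - split; [exact Hx|exact Hz'].
Qed.

Lemma sum_n_S (a : nat -> R) (n : nat) : sum_n a (S n) = sum_n a n + a (S n) :> R.
Proof. now rewrite sum_Sn. Qed.

Lemma sum_n_scal_l (c : R) (a : nat -> R) (n : nat) :
  sum_n (fun k => c * a k) n = c * sum_n a n :> R.
Proof. apply (sum_n_mult_l (K := R_AbsRing)). Qed.

Definition lincomb (c : nat -> R) (u : nat -> R -> R) (n : nat) (x : R) : R :=
  sum_n (fun j => c j * u j x) n.

Lemma lincomb_0 (c : nat -> R) (u : nat -> R -> R) (x : R) :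
  lincomb c u 0 x = c 0%nat * u 0%nat x.
Proof. unfold lincomb. now rewrite sum_O. Qed.

Lemma lincomb_S (c : nat -> R) (u : nat -> R -> R) (n : nat) (x : R) :
  lincomb c u (S n) x = lincomb c u n x + c (S n) * u (S n) x.
Proof. apply sum_n_S. Qed.

Lemma continuous_on_ext (D : R -> Prop) (u v : R -> R) :
  (forall x, u x = v x) -> continuous_on D u -> continuous_on D v.
Proof.
  intros E Hu x Hx. rewrite <- E.
  apply filterlim_ext with u; [exact E|]. now apply Hu.
Qed.

Lemma continuous_on_lincomb (D : R -> Prop) (c : nat -> R) (u : nat -> R -> R)
    (n : nat) :
  (forall j, continuous_on D (u j)) -> continuous_on D (lincomb c u n).
Proof.
  intros Hu. induction n as [|n IH].
  - apply continuous_on_ext with (fun x => c 0%nat * u 0%nat x).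
    + intros x. symmetry. apply lincomb_0.
    + apply continuous_on_mult; [apply continuous_on_const|apply Hu].
  - apply continuous_on_ext with (fun x => lincomb c u n x + c (S n) * u (S n) x).
    + intros x. symmetry. apply lincomb_S.
    + apply continuous_on_plus; [exact IH|].
      apply continuous_on_mult; [apply continuous_on_const|apply Hu].
Qed.

(** * The inner product on [0,1]: projections and Bessel's inequality *)

Lemma unit_interval_of_range (x : R) :
  Rmin 0 1 < x < Rmax 0 1 -> unit_interval x.
Proof. rewrite Rmin_left, Rmax_right by lra. unfold unit_interval. lra. Qed.

Lemma ex_RInt_unit_interval (u : R -> R) :
  continuous_on unit_interval u -> ex_RInt u 0 1.
Proof.
  intros Hu. apply (ex_RInt_ext (fun x => u (clamp x))).
  - intros x Hx. now rewrite clamp_id by now apply unit_interval_of_range.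
  - apply (ex_RInt_continuous (V := R_CompleteNormedModule)). intros x _.
    now apply continuous_clamped.
Qed.

Lemma inner_ext (u v u' v' : R -> R) :
  (forall x, unit_interval x -> u x = u' x) ->
  (forall x, unit_interval x -> v x = v' x) -> inner u v = inner u' v'.
Proof.
  intros Hu Hv. apply RInt_ext. intros x Hx.
  apply unit_interval_of_range in Hx. now rewrite Hu, Hv.
Qed.

Lemma inner_comm (u v : R -> R) : inner u v = inner v u.
Proof. apply RInt_ext. intros. apply Rmult_comm. Qed.

Lemma inner_plus_r (w u v : R -> R) :
  continuous_on unit_interval w -> continuous_on unit_interval u ->
  continuous_on unit_interval v ->
  inner w (fun x => u x + v x) = inner w u + inner w v.
Proof.
  intros Hw Hu Hv. unfold inner.
  rewrite <- (RInt_plus (V := R_CompleteNormedModule) (fun x => w x * u x)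
    (fun x => w x * v x)) by (apply ex_RInt_unit_interval; now apply continuous_on_mult).
  apply RInt_ext. intros. apply Rmult_plus_distr_l.
Qed.

Lemma inner_scal_r (w u : R -> R) (c : R) :
  continuous_on unit_interval w -> continuous_on unit_interval u ->
  inner w (fun x => c * u x) = c * inner w u.
Proof.
  intros Hw Hu. unfold inner.
  rewrite <- (RInt_scal (V := R_CompleteNormedModule) (fun x => w x * u x))
    by (apply ex_RInt_unit_interval; now apply continuous_on_mult).
  apply RInt_ext. intros x _. unfold scal. simpl. unfold mult. simpl. ring.
Qed.

Lemma inner_lincomb_r (w : R -> R) (c : nat -> R) (u : nat -> R -> R) (n : nat) :
  continuous_on unit_interval w -> (forall j, continuous_on unit_interval (u j)) ->
  inner w (lincomb c u n) = sum_n (fun j => c j * inner w (u j)) n.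
Proof.
  intros Hw Hu. induction n as [|n IH].
  - rewrite sum_O, <- inner_scal_r by auto.
    apply inner_ext; auto using lincomb_0.
  - rewrite sum_n_S, <- IH, <- inner_scal_r by auto.
    rewrite <- (inner_plus_r w (lincomb c u n)); auto.
    + apply inner_ext; auto using lincomb_S.
    + now apply continuous_on_lincomb.
    + apply continuous_on_mult; [apply continuous_on_const|apply Hu].
Qed.

(** For orthonormal [u] and coefficients [inner v (u j)], this is [v] minus its orthogonal
    projection onto [u 0], ..., [u n]. The factor [-1] lets the rules for sums and multiples of
    inner products apply. *)
Definition residual (v : R -> R) (c : nat -> R) (u : nat -> R -> R) (n : nat)
    (x : R) : R :=
  v x + (-1) * lincomb c u n x.

Lemma continuous_on_residual (v : R -> R) (c : nat -> R) (u : nat -> R -> R) (n : nat) :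
  continuous_on unit_interval v -> (forall j, continuous_on unit_interval (u j)) ->
  continuous_on unit_interval (residual v c u n).
Proof.
  intros Hv Hu. apply continuous_on_plus; [exact Hv|].
  apply continuous_on_mult; [apply continuous_on_const|].
  now apply continuous_on_lincomb.
Qed.

Lemma inner_residual_r (w v : R -> R) (c : nat -> R) (u : nat -> R -> R) (n : nat) :
  continuous_on unit_interval w -> continuous_on unit_interval v ->
  (forall j, continuous_on unit_interval (u j)) ->
  inner w (residual v c u n) =
  inner w v - sum_n (fun j => c j * inner w (u j)) n.
Proof.
  intros Hw Hv Hu. unfold residual.
  pose proof (continuous_on_lincomb unit_interval c u n Hu) as Hl.
  rewrite inner_plus_r, inner_scal_r, inner_lincomb_r
    by auto using continuous_on_mult, continuous_on_const.
  ring.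
Qed.

Lemma inner_self_nonneg (u : R -> R) :
  continuous_on unit_interval u -> 0 <= inner u u.
Proof.
  intros Hu. apply RInt_ge_0; [lra| |].
  - apply ex_RInt_unit_interval. now apply continuous_on_mult.
  - intros. apply Rle_0_sqr.
Qed.

Definition orthonormal (u : nat -> R -> R) : Prop :=
  forall i j, inner (u i) (u j) = if Nat.eqb i j then 1 else 0.

Lemma sum_n_kronecker (c : nat -> R) (m n : nat) :
  sum_n (fun j => c j * (if Nat.eqb m j then 1 else 0)) n =
  (if Nat.leb m n then c m else 0) :> R.
Proof.
  induction n as [|n IH].
  - rewrite sum_O. destruct m; simpl; ring.
  - rewrite sum_n_S, IH.
    destruct (Nat.eqb_spec m (S n)) as [->|Hne].
    + rewrite (proj2 (Nat.leb_gt (S n) n)) by lia.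
      rewrite (proj2 (Nat.leb_le (S n) (S n))) by lia. ring.
    + destruct (Nat.leb_spec m n); destruct (Nat.leb_spec m (S n)); try lia; ring.
Qed.

(** Pythagoras: [r] is orthogonal to every [u j] with [j <= n], so [inner r r] reduces to
    [inner r v]. *)
Lemma inner_residual_self (v : R -> R) (u : nat -> R -> R) (n : nat) :
  continuous_on unit_interval v -> (forall j, continuous_on unit_interval (u j)) ->
  orthonormal u ->
  let r := residual v (fun j => inner v (u j)) u n in
  inner r r = inner v v - sum_n (fun j => inner v (u j) * inner v (u j)) n.
Proof.
  intros Hv Hu Ho r.
  assert (Hr : continuous_on unit_interval r) by now apply continuous_on_residual.
  unfold r at 2. rewrite inner_residual_r by auto.
  rewrite (inner_comm r v). unfold r at 1. rewrite inner_residual_r by auto.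
  rewrite (sum_n_ext_loc (fun j => _ * inner r (u j)) (fun j => 0)).
  - rewrite sum_n_const. ring.
  - intros j Hj. rewrite (inner_comm r). unfold r.
    rewrite inner_residual_r by auto. rewrite (inner_comm (u j) v).
    rewrite (sum_n_ext _ (fun i => inner v (u i) * (if Nat.eqb j i then 1 else 0))).
    + rewrite sum_n_kronecker, (proj2 (Nat.leb_le j n) Hj). ring_R.
    + intros i. now rewrite Ho.
Qed.

Lemma bessel (v : R -> R) (u : nat -> R -> R) (n : nat) :
  continuous_on unit_interval v -> (forall j, continuous_on unit_interval (u j)) ->
  orthonormal u -> sum_n (fun j => inner v (u j) * inner v (u j)) n <= inner v v.
Proof.
  intros Hv Hu Ho. pose proof (inner_residual_self v u n Hv Hu Ho) as E. simpl in E.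
  pose proof (inner_self_nonneg _ (continuous_on_residual v
    (fun j => inner v (u j)) u n Hv Hu)). lra.
Qed.

(** * Eigenfunctions, and sums over a spectrum *)

Definition symmetric_kernel (C : R -> R -> R) : Prop :=
  forall x y, unit_interval x -> unit_interval y -> C x y = C y x.

Definition continuous_kernel (C : R -> R -> R) : Prop :=
  continuous_on unit_square (fun p : R * R => C (fst p) (snd p)).

Lemma covariance_operator_inner (C : R -> R -> R) (u : R -> R) (x : R) :
  covariance_operator C u x = inner (C x) u.
Proof. reflexivity. Qed.

(** Fubini for the integrand C(x,y) u(y) v(x), then symmetry of the kernel. The clamped version [F]
    is continuous on the whole plane, as [RInt_Fubini] demands, and agrees with that integrand on
    the unit square. *)
Lemma covariance_operator_selfadjoint (C : R -> R -> R) (u v : R -> R) :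
  symmetric_kernel C -> continuous_kernel C ->
  continuous_on unit_interval u -> continuous_on unit_interval v ->
  inner (covariance_operator C u) v = inner u (covariance_operator C v).
Proof.
  intros Hs Hc Hu Hv.
  pose (F := fun x y => C (clamp x) (clamp y) * u (clamp y) * v (clamp x)).
  assert (HF : forall x y, continuity_2d_pt F x y).
  { intros x y. apply continuity_2d_pt_mult; [apply continuity_2d_pt_mult|];
      apply continuity_2d_pt_filterlim.
    - now apply (continuous_clamped_2 C (x, y)).
    - apply (continuous_comp (fun z : R * R => snd z) (fun y => u (clamp y)) (x, y)).
      + apply continuous_snd.
      + now apply continuous_clamped.
    - apply (continuous_comp (fun z : R * R => fst z) (fun y => v (clamp y)) (x, y)).
      + apply continuous_fst.
      + now apply continuous_clamped. }
  transitivity (RInt (fun x => RInt (F x) 0 1) 0 1).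
  - apply RInt_ext. intros x Hx. apply unit_interval_of_range in Hx.
    rewrite Rmult_comm.
    transitivity (inner (C x) (fun y => v x * u y)).
    + rewrite inner_scal_r; auto. now apply continuous_on_section.
    + apply RInt_ext. intros y Hy. apply unit_interval_of_range in Hy.
      unfold F. rewrite !clamp_id by auto. ring_R.
  - rewrite RInt_Fubini by (auto; lra).
    apply RInt_ext. intros x Hx. apply unit_interval_of_range in Hx.
    transitivity (inner (C x) (fun y => u x * v y)).
    + apply RInt_ext. intros y Hy. apply unit_interval_of_range in Hy.
      unfold F. rewrite !clamp_id, (Hs y x) by auto. ring_R.
    + rewrite inner_scal_r; auto. now apply continuous_on_section.
Qed.

Lemma eigenfunctions_orthogonal (C : R -> R -> R) (a b : R) (u v : R -> R) :
  symmetric_kernel C -> continuous_kernel C ->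
  eigenpair C a u -> eigenpair C b v -> a <> b -> inner u v = 0.
Proof.
  intros Hs Hc [Hu _ Eu] [Hv _ Ev] Hab.
  pose proof (covariance_operator_selfadjoint C u v Hs Hc Hu Hv) as E.
  rewrite (inner_ext _ v (fun x => a * u x) v) in E by auto.
  rewrite (inner_ext u _ u (fun x => b * v x)) in E by auto.
  rewrite inner_comm, !inner_scal_r, (inner_comm v u) in E by auto.
  apply Rmult_eq_reg_l with (a - b); [|lra]. lra.
Qed.

(** [positive_spectrum] without the ordering, which a shift of one eigenvalue may destroy. *)
Record eigenbasis (C : R -> R -> R) (a : nat -> R) (u : nat -> R -> R) : Prop := {
  eigenbasis_positive : forall i, 0 < a i;
  eigenbasis_eigenpair : forall i, eigenpair C (a i) (u i);
  eigenbasis_orthonormal : orthonormal u;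
  eigenbasis_complete : forall l psi, 0 < l -> eigenpair C l psi ->
    exists i, inner psi (u i) <> 0
}.

Lemma positive_spectrum_eigenbasis (C : R -> R -> R) (a : nat -> R)
    (u : nat -> R -> R) : positive_spectrum C a u -> eigenbasis C a u.
Proof. now intros []; split. Qed.

(* The difference between v and its projection onto u 0, ..., u n would be an
   eigenfunction orthogonal to every u j. *)
Lemma parseval_eigenbasis (C : R -> R -> R) (a : nat -> R) (u : nat -> R -> R)
    (l : R) (v : R -> R) (n : nat) :
  symmetric_kernel C -> continuous_kernel C -> eigenbasis C a u ->
  0 < l -> eigenpair C l v -> (forall j, (n < j)%nat -> a j < l) ->
  inner v v = sum_n (fun j => inner v (u j) * inner v (u j)) n.
Proof.
  intros Hs Hc [Ha Hu Ho Hcomp] Hl Hv Hn.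
  assert (Cu : forall j, continuous_on unit_interval (u j)) by (intros j; apply Hu).
  assert (Cv : continuous_on unit_interval v) by apply Hv.
  pose (r := residual v (fun j => inner v (u j)) u n).
  assert (Cr : continuous_on unit_interval r) by now apply continuous_on_residual.
  assert (Hperp : forall j, a j <> l -> inner v (u j) = 0).
  { intros j Hj. apply (eigenfunctions_orthogonal C l (a j)); auto. }
  assert (Hr : forall j, inner r (u j) = 0).
  { intros j. rewrite inner_comm. unfold r. rewrite inner_residual_r by auto.
    rewrite (sum_n_ext _ (fun i => inner v (u i) * (if Nat.eqb j i then 1 else 0)))
      by (intros; now rewrite Ho).
    rewrite sum_n_kronecker, (inner_comm (u j) v).
    (* Up to [n] the projection removes the component along [u j]; beyond [n] the eigenvalue is
       below [l], so [v] is already orthogonal to [u j]. *)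
    destruct (Nat.leb_spec j n) as [Hj|Hj]; [ring_R|].
    rewrite Hperp; [ring_R|]. specialize (Hn j Hj). lra. }
  assert (Er : forall x, unit_interval x -> covariance_operator C r x = l * r x).
  { intros x Hx. rewrite covariance_operator_inner. unfold r.
    rewrite inner_residual_r by (auto; now apply continuous_on_section).
    rewrite <- covariance_operator_inner, (eigenfunction_equation _ _ _ Hv x Hx).
    unfold residual, lincomb.
    rewrite (sum_n_ext _ (fun j => l * (inner v (u j) * u j x))).
    - rewrite sum_n_scal_l. ring_R.
    - intros j. rewrite <- covariance_operator_inner,
        (eigenfunction_equation _ _ _ (Hu j) x Hx).
      destruct (Req_dec (a j) l) as [->|Hj]; [ring_R|].
      rewrite Hperp by exact Hj. ring_R. }
  assert (Hz : forall x, unit_interval x -> r x = 0).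
  { intros x Hx. destruct (Req_dec (r x) 0) as [H0|H0]; [exact H0|].
    destruct (Hcomp l r Hl) as [j Hj]; [|now elim Hj].
    split; auto. now exists x. }
  pose proof (inner_residual_self v u n Cv Cu Ho) as E. simpl in E. fold r in E.
  rewrite (inner_ext r r (fun _ => 0) (fun x => 0 * 0)) in E
    by (auto; intros; rewrite Hz by auto; ring_R).
  rewrite inner_scal_r in E by apply continuous_on_const. lra.
Qed.

(** Supplies one truncation index at which Parseval's identity is valid for all of the first
    eigenfunctions of the other basis at once. *)
Lemma eventually_below_finitely_many (a b : nat -> R) (K : nat) :
  is_lim_seq a 0 -> (forall k, 0 < b k) ->
  exists J, forall k j, (k <= K)%nat -> (J < j)%nat -> a j < b k.
Proof.
  intros Ha Hb.
  assert (H1 : forall k, exists J, forall j, (J < j)%nat -> a j < b k).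
  { intros k. apply is_lim_seq_spec in Ha.
    destruct (Ha (mkposreal _ (Hb k))) as [N HN]. exists N. intros j Hj.
    specialize (HN j (Nat.lt_le_incl _ _ Hj)). simpl in HN.
    apply Rabs_lt_between in HN. lra. }
  induction K as [|K [J HJ]].
  - destruct (H1 0%nat) as [J HJ]. exists J. intros k j Hk.
    replace k with 0%nat by lia. apply HJ.
  - destruct (H1 (S K)) as [J' HJ']. exists (Nat.max J J'). intros k j Hk Hj.
    destruct (Nat.eq_dec k (S K)) as [->|Hne].
    + apply HJ'. lia.
    + apply HJ; lia.
Qed.

Lemma sum_n_le (a b : nat -> R) (n : nat) :
  (forall k, a k <= b k) -> sum_n a n <= sum_n b n.
Proof. intros H. apply sum_n_m_le, H. Qed.

(* Double counting of sum_{j,k} g(b k) <v k, u j>^2: Parseval in j gives the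
   left-hand side, and Bessel in k bounds it by the right-hand side, since
   g(b k) may be replaced by g(a j) wherever <v k, u j> <> 0. *)
Lemma eigenbasis_domination (C : R -> R -> R) (a b : nat -> R)
    (u v : nat -> R -> R) (g : R -> R) (K : nat) :
  symmetric_kernel C -> continuous_kernel C ->
  eigenbasis C a u -> eigenbasis C b v -> is_lim_seq a 0 -> (forall x, 0 < x -> 0 <= g x) ->
  exists J, sum_n (fun k => g (b k)) K <= sum_n (fun j => g (a j)) J.
Proof.
  intros Hs Hc Hu Hv Ha Hg.
  destruct (eventually_below_finitely_many a b K Ha) as [J HJ]; [apply Hv|].
  exists J.
  assert (Cu : forall j, continuous_on unit_interval (u j)) by (intros j; apply Hu).
  assert (Cv : forall j, continuous_on unit_interval (v j)) by (intros j; apply Hv).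
  rewrite (sum_n_ext_loc _ (fun k => sum_n (fun j =>
    g (a j) * (inner (u j) (v k) * inner (u j) (v k))) J)).
  - rewrite sum_n_switch. apply sum_n_le. intros j.
    rewrite sum_n_scal_l.
    rewrite <- (Rmult_1_r (g (a j))) at 2. apply Rmult_le_compat_l; [apply Hg, Hu|].
    replace 1 with (inner (u j) (u j)) by
      (rewrite (eigenbasis_orthonormal _ _ _ Hu); now rewrite Nat.eqb_refl).
    apply bessel; auto. apply Hv.
  - intros k Hk. rewrite <- (Rmult_1_r (g (b k))).
    replace 1 with (inner (v k) (v k)) by
      (rewrite (eigenbasis_orthonormal _ _ _ Hv); now rewrite Nat.eqb_refl).
    rewrite (parseval_eigenbasis C a u (b k) (v k) J); auto; try apply Hv.
    rewrite <- sum_n_scal_l. apply sum_n_ext. intros j.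
    rewrite (inner_comm (v k)).
    destruct (Req_dec (a j) (b k)) as [->|Hne]; [reflexivity|].
    rewrite (eigenfunctions_orthogonal C (a j) (b k)); auto; [ring_R|apply Hu|apply Hv].
Qed.

(** Partial sums of nonnegative terms increase to their supremum, and mutual domination makes the
    two suprema equal. *)
Lemma is_series_mutual_domination (x y : nat -> R) (s : R) :
  (forall k, 0 <= x k) -> (forall k, 0 <= y k) ->
  (forall K, exists J, sum_n y K <= sum_n x J) ->
  (forall K, exists J, sum_n x K <= sum_n y J) ->
  is_series x s -> is_series y s.
Proof.
  intros Hx Hy Hyx Hxy Hs.
  assert (Hincr : forall z : nat -> R, (forall k, 0 <= z k) ->
    forall n, sum_n z n <= sum_n z (S n)).
  { intros z Hz n. rewrite sum_n_S. specialize (Hz (S n)). lra. }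
  assert (Bx : forall K, sum_n x K <= s).
  { apply is_lim_seq_incr_compare; [exact Hs|auto]. }
  assert (By : forall K, sum_n y K <= s).
  { intros K. destruct (Hyx K) as [J HJ]. eapply Rle_trans; [exact HJ|apply Bx]. }
  destruct (ex_finite_lim_seq_incr (sum_n y) s) as [s' Hs']; auto.
  assert (By' : forall K, sum_n y K <= s') by (apply is_lim_seq_incr_compare; auto).
  assert (E : s = s').
  { apply Rle_antisym.
    - apply (is_lim_seq_le (sum_n x) (fun _ => s') s s'); [|exact Hs|apply is_lim_seq_const].
      intros K. destruct (Hxy K) as [J HJ]. eapply Rle_trans; [exact HJ|apply By'].
    - apply (is_lim_seq_le (sum_n y) (fun _ => s) s' s); auto. apply is_lim_seq_const. }
  now rewrite E.
Qed.

(** Domination holds in both directions once both sequences tend to 0. For [b] this comes from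
    domination with [g] the identity, which bounds the partial sums of [b] by the sum of [a]. *)
Lemma eigenbasis_series (C : R -> R -> R) (a b : nat -> R)
    (u v : nat -> R -> R) (g : R -> R) (s : R) :
  symmetric_kernel C -> continuous_kernel C ->
  eigenbasis C a u -> eigenbasis C b v -> ex_series a -> (forall x, 0 < x -> 0 <= g x) ->
  is_series (fun j => g (a j)) s <-> is_series (fun k => g (b k)) s.
Proof.
  intros Hs Hc Hu Hv Ha Hg.
  pose proof (ex_series_lim_0 a Ha) as La.
  assert (Lb : is_lim_seq b 0).
  { apply (ex_series_lim_0 b).
    destruct Ha as [sa Hsa].
    destruct (ex_finite_lim_seq_incr (sum_n b) sa) as [sb Hsb]; [| |now exists sb].
    - intros n. rewrite sum_n_S.
      pose proof (eigenbasis_positive _ _ _ Hv (S n)). lra.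
    - intros K. destruct (eigenbasis_domination C a b u v (fun x => x) K) as [J HJ];
        auto using Rlt_le.
      eapply Rle_trans; [exact HJ|].
      apply (is_lim_seq_incr_compare (sum_n a)); [exact Hsa|].
      intros n. rewrite sum_n_S.
      pose proof (eigenbasis_positive _ _ _ Hu (S n)). lra. }
  pose proof (eigenbasis_positive _ _ _ Hu). pose proof (eigenbasis_positive _ _ _ Hv).
  split; apply is_series_mutual_domination; auto;
    intros K; eapply eigenbasis_domination; eauto.
Qed.

(** * The rank-one perturbation of the kernel *)

Lemma perturbed_kernel_continuous (C : R -> R -> R) (phi : R -> R) (t : R) :
  continuous_kernel C -> continuous_on unit_interval phi ->
  continuous_kernel (perturbed_kernel C phi t).
Proof.
  intros HC Hphi [x y] Hxy. unfold perturbed_kernel.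
  assert (H1 : filterlim (fun p : R * R => phi (fst p))
    (within unit_square (locally (x, y))) (locally (phi x))).
  { intros P HP. destruct (Hphi x (proj1 Hxy) P HP) as [d Hd]. exists d.
    intros z [Hz _] Hz'. apply Hd; [exact Hz|apply Hz']. }
  assert (H2 : filterlim (fun p : R * R => phi (snd p))
    (within unit_square (locally (x, y))) (locally (phi y))).
  { intros P HP. destruct (Hphi y (proj2 Hxy) P HP) as [d Hd]. exists d.
    intros z [_ Hz] Hz'. apply Hd; [exact Hz|apply Hz']. }
  refine (filterlim_comp_2 _ _ _ (HC (x, y) Hxy) _
    (filterlim_plus (V := R_NormedModule) (C x y) (t * phi x * phi y))).
  refine (filterlim_comp_2 _ _ _ _ H2 (filterlim_mult (K := R_AbsRing) (t * phi x) (phi y))).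
  exact (filterlim_comp_2 _ _ _ (filterlim_const t) H1
    (filterlim_mult (K := R_AbsRing) t (phi x))).
Qed.

Lemma covariance_operator_perturbed (C : R -> R -> R) (phi psi : R -> R) (t x : R) :
  continuous_kernel C -> continuous_on unit_interval phi ->
  continuous_on unit_interval psi -> unit_interval x ->
  covariance_operator (perturbed_kernel C phi t) psi x =
  covariance_operator C psi x + t * phi x * inner psi phi.
Proof.
  intros HC Hphi Hpsi Hx. rewrite !covariance_operator_inner.
  pose proof (continuous_on_section C x HC Hx) as HCx.
  unfold perturbed_kernel.
  rewrite inner_comm, (inner_plus_r psi (C x) (fun y => t * phi x * phi y)); auto.
  - now rewrite inner_scal_r, (inner_comm psi (C x)).
  - apply continuous_on_mult; [apply continuous_on_const|exact Hphi].
Qed.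

Definition shift_at (lam : nat -> R) (i : nat) (t : R) (j : nat) : R :=
  if Nat.eqb j i then lam i + t else lam j.

(** For completeness: an eigenfunction of the perturbed kernel either has a nonzero component along
    [phi i], or is orthogonal to it. In the second case the perturbation does not act on it, and the
    completeness for [C] applies. *)
Lemma perturbed_eigenbasis (C : R -> R -> R) (lam : nat -> R)
    (phi : nat -> R -> R) (i : nat) (t : R) :
  continuous_kernel C -> eigenbasis C lam phi -> 0 < lam i + t ->
  eigenbasis (perturbed_kernel C (phi i) t) (shift_at lam i t) phi.
Proof.
  intros HC [Hpos Heig Ho Hcomp] Ht.
  assert (Cphi : forall j, continuous_on unit_interval (phi j))
    by (intros j; apply Heig).
  split; auto.
  - intros j. unfold shift_at. destruct (Nat.eqb_spec j i); auto.
  - intros j. destruct (Heig j) as [Hj Hj0 Ej]. split; auto.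
    intros x Hx. rewrite covariance_operator_perturbed, Ej, Ho by auto.
    unfold shift_at. destruct (Nat.eqb_spec j i) as [->|_]; ring_R.
  - intros l psi Hl Hpsi.
    destruct (Req_dec (inner psi (phi i)) 0) as [H0|H0]; [|now exists i].
    apply (Hcomp l psi Hl). destruct Hpsi as [Cpsi Npsi Epsi]. split; auto.
    intros x Hx. rewrite <- Epsi by exact Hx.
    rewrite covariance_operator_perturbed, H0 by auto. ring_R.
Qed.

(** * Reverse water-filling *)

(** A surplus at a single index survives summation. This yields the strict inequalities between
    series and the bound on the move of the water level. *)
Lemma is_series_le_at (a b : nat -> R) (sa sb c : R) (p : nat) :
  is_series a sa -> is_series b sb -> (forall j, a j <= b j) ->
  a p + c <= b p -> sa + c <= sb.
Proof.
  intros Ha Hb Hab Hp.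
  assert (H : forall n, (p <= n)%nat -> sum_n a n + c <= sum_n b n).
  { assert (Hle : forall n, sum_n a n <= sum_n b n)
      by (intros n; now apply sum_n_le).
    intros n Hn. destruct n as [|n].
    - replace p with 0%nat in Hp by lia. now rewrite !sum_O.
    - rewrite !sum_n_S. revert Hn. induction n as [|n IH]; intros Hn.
      + destruct (Nat.eq_dec p 1) as [->|Hne].
        * specialize (Hle 0%nat). lra.
        * replace p with 0%nat in Hp by lia. rewrite !sum_O. specialize (Hab 1%nat). lra.
      + destruct (Nat.eq_dec p (S (S n))) as [->|Hne].
        * specialize (Hle (S n)). lra.
        * rewrite !sum_n_S. specialize (Hab (S (S n))).
          assert (p <= S n)%nat by lia. specialize (IH H). lra. }
  apply (is_lim_seq_le_loc (fun n => sum_n a n + c) (sum_n b) (sa + c) sb).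
  - now exists p.
  - apply (is_lim_seq_plus' (sum_n a) (fun _ => c)); [exact Ha|apply is_lim_seq_const].
  - exact Hb.
Qed.

Lemma is_series_le (a b : nat -> R) (sa sb : R) :
  is_series a sa -> is_series b sb -> (forall j, a j <= b j) -> sa <= sb.
Proof.
  intros Ha Hb Hab.
  pose proof (is_series_le_at a b sa sb 0 0 Ha Hb Hab). specialize (Hab 0%nat). lra.
Qed.

Lemma is_series_zero : is_series (fun _ : nat => 0) 0.
Proof.
  change (is_lim_seq (sum_n (fun _ : nat => 0)) 0).
  apply (is_lim_seq_ext (fun _ => 0)); [|apply is_lim_seq_const].
  intros n. rewrite sum_n_const. ring.
Qed.

Lemma is_series_change_at (a b : nat -> R) (i : nat) (s : R) :
  (forall j, j <> i -> b j = a j) -> is_series a s -> is_series b (s + (b i - a i)).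
Proof.
  intros Hab Ha.
  change (is_lim_seq (sum_n b) (s + (b i - a i))).
  apply (is_lim_seq_ext_loc (fun n => sum_n a n + (b i - a i))).
  - exists i. intros n Hn.
    assert (E : sum_n b n = sum_n a n +
      sum_n (fun j => (b j - a j) * (if Nat.eqb i j then 1 else 0)) n :> R).
    { rewrite <- (sum_n_plus (G := R_AbelianMonoid)). apply sum_n_ext. intros j.
      change (b j = a j + (b j - a j) * (if Nat.eqb i j then 1 else 0)).
      destruct (Nat.eqb_spec i j) as [->|Hne]; [ring|]. rewrite Hab by auto. ring. }
    rewrite sum_n_kronecker, (proj2 (Nat.leb_le i n) Hn) in E. now rewrite E.
  - apply (is_lim_seq_plus' (sum_n a) (fun _ => b i - a i));
      [exact Ha|apply is_lim_seq_const].
Qed.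

Lemma is_series_change_image (g : R -> R) (x y : nat -> R) (i : nat) (s : R) :
  (forall j, j <> i -> y j = x j) -> is_series (fun j => g (x j)) s ->
  is_series (fun j => g (y j)) (s + (g (y i) - g (x i))).
Proof.
  intros Hxy. apply (is_series_change_at (fun j => g (x j)) (fun j => g (y j)) i s).
  intros j Hj. now rewrite Hxy.
Qed.

(** * Lagrangian duality for one component and for the sum *)

Lemma ln_le_minus_1 (x : R) : 0 < x -> ln x <= x - 1.
Proof.
  intros Hx. pose proof (exp_ineq1_le (ln x)) as H. rewrite exp_ln in H by exact Hx. lra.
Qed.

(** Twice the information spent at level [m] on a component of variance [x]; the capacity constraint
    then reads [2 * rho]. *)
Definition log_excess (m x : R) : R := Rmax 0 (ln (x / m)).

Lemma log_excess_high (m x : R) : 0 < m <= x -> log_excess m x = ln x - ln m.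
Proof.
  intros [Hm Hx]. unfold log_excess. rewrite ln_div by lra.
  apply Rmax_right. assert (ln m <= ln x) by (apply ln_le; lra). lra.
Qed.

Lemma log_excess_low (m x : R) : 0 < x <= m -> log_excess m x = 0.
Proof.
  intros [Hx Hm]. unfold log_excess. rewrite ln_div by lra.
  apply Rmax_left. assert (ln x <= ln m) by (apply ln_le; lra). lra.
Qed.

(* The minimum of D + m ln(x/D) over 0 < D <= x: the contribution of a
   component of variance x to the Lagrangian of reverse water-filling. *)
Definition lagrangian_term (m x : R) : R := Rmin m x + m * log_excess m x.

Lemma lagrangian_term_high (m x : R) :
  0 < m <= x -> lagrangian_term m x = m + m * (ln x - ln m).
Proof.
  intros H. unfold lagrangian_term. rewrite log_excess_high, Rmin_left by lra. ring.
Qed.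

Lemma lagrangian_term_low (m x : R) : 0 < x <= m -> lagrangian_term m x = x.
Proof.
  intros H. unfold lagrangian_term. rewrite log_excess_low, Rmin_right by lra. ring.
Qed.

(** The tangent line of the logarithm at [a]; concavity of the Lagrangian and weak duality both rest
    on it. *)
Lemma scaled_ln_diff_le (a b : R) : 0 < a -> 0 < b -> a * (ln b - ln a) <= b - a.
Proof.
  intros Ha Hb. rewrite <- ln_div by lra.
  pose proof (ln_le_minus_1 (b / a) (Rdiv_lt_0_compat _ _ Hb Ha)) as H.
  apply Rmult_le_compat_l with (r := a) in H; [|lra].
  replace (a * (b / a - 1)) with (b - a) in H by (field; lra). exact H.
Qed.

(** The term is x up to [m] and m + m ln(x/m) beyond, and both pieces have slope 1 at [m]. It is
    thus concave with derivative min(1, m/a) at [a], and lies below its tangent there. *)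
Lemma lagrangian_term_concave (m a b : R) :
  0 < m -> 0 < a -> 0 < b ->
  lagrangian_term m b <= lagrangian_term m a + (b - a) * Rmin 1 (m / a).
Proof.
  intros Hm Ha Hb.
  destruct (Rle_dec m a) as [Hma|Hma].
  - rewrite (lagrangian_term_high m a), Rmin_right by
      (try (apply Rcomplements.Rle_div_l; lra); lra).
    destruct (Rle_dec m b) as [Hmb|Hmb].
    + rewrite lagrangian_term_high by lra.
      pose proof (scaled_ln_diff_le a b Ha Hb) as H.
      apply Rmult_le_compat_l with (r := m / a) in H; [|left; now apply Rdiv_lt_0_compat].
      replace (m / a * (a * (ln b - ln a))) with (m * (ln b - ln a)) in H by (field; lra).
      lra.
    + rewrite lagrangian_term_low by lra.
      pose proof (scaled_ln_diff_le a m Ha Hm) as H.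
      apply Rmult_le_compat_l with (r := m / a) in H; [|left; now apply Rdiv_lt_0_compat].
      replace (m / a * (a * (ln m - ln a))) with (m * (ln m - ln a)) in H by (field; lra).
      assert (0 <= (m - b) * (1 - m / a)).
      { apply Rmult_le_pos; [lra|].
        assert (m / a <= 1) by (apply Rcomplements.Rle_div_l; lra). lra. }
      lra.
  - rewrite (lagrangian_term_low m a), Rmin_left by
      (try (apply Rcomplements.Rle_div_r; lra); lra).
    destruct (Rle_dec m b) as [Hmb|Hmb].
    + rewrite lagrangian_term_high by lra.
      pose proof (scaled_ln_diff_le m b Hm Hb). lra.
    + rewrite lagrangian_term_low by lra. lra.
Qed.

(* Weak duality, one component at a time. *)
Lemma lagrangian_term_dual (m mu x : R) :
  0 < m -> 0 < mu -> 0 < x ->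
  lagrangian_term m x - m * log_excess mu x <= Rmin mu x.
Proof.
  intros Hm Hmu Hx.
  destruct (Rle_dec m x) as [Hmx|Hmx]; destruct (Rle_dec mu x) as [Hmux|Hmux].
  - rewrite lagrangian_term_high, log_excess_high, Rmin_left by lra.
    pose proof (scaled_ln_diff_le m mu Hm Hmu). lra.
  - rewrite lagrangian_term_high, log_excess_low, Rmin_right by lra.
    pose proof (scaled_ln_diff_le m x Hm Hx). lra.
  - rewrite lagrangian_term_low, log_excess_high, Rmin_left by lra.
    pose proof (scaled_ln_diff_le x mu Hx Hmu).
    assert (ln mu <= ln x) by (apply ln_le; lra).
    assert (0 <= (m - x) * (ln x - ln mu)) by (apply Rmult_le_pos; lra). lra.
  - rewrite lagrangian_term_low, log_excess_low, Rmin_right by lra. lra.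
Qed.

Lemma water_level_log_excess (x : nat -> R) (rho mu : R) :
  water_level x rho mu <->
  0 < mu /\ is_series (fun j => log_excess mu (x j)) (2 * rho).
Proof.
  split; intros [Hmu H]; split; auto.
  - apply (is_series_ext (fun j => scal 2 (/ 2 * Rmax 0 (ln (x j / mu))))).
    + intros j. unfold scal; simpl; unfold mult; simpl. unfold log_excess. field.
    + now apply (is_series_scal (V := R_NormedModule) 2).
  - replace rho with (/ 2 * (2 * rho)) by field.
    now apply (is_series_scal (V := R_NormedModule) (/ 2)).
Qed.

(** With its own multiplier [mux], the program for [x] has Lagrangian value exactly
    [Vx + mux * (2 * rho)]. The same multiplier used for [y] gives a lower bound on [Vy] by weak
    duality. Both levels spend the same capacity, so the constraint terms cancel and only the change
    of term [i] remains; the tangent is taken at [y i]. *)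
Lemma residual_change_lower (x y : nat -> R) (i : nat) (rho mux muy Vx Vy : R) :
  (forall j, 0 < x j) -> (forall j, 0 < y j) -> (forall j, j <> i -> y j = x j) ->
  water_level x rho mux -> water_level y rho muy ->
  is_series (fun j => Rmin mux (x j)) Vx -> is_series (fun j => Rmin muy (y j)) Vy ->
  (y i - x i) * Rmin 1 (mux / y i) <= Vy - Vx.
Proof.
  intros Hx Hy Hxy Wx Wy Sx Sy.
  apply water_level_log_excess in Wx. apply water_level_log_excess in Wy.
  destruct Wx as [Hmx Wx]. destruct Wy as [Hmy Wy].
  pose proof (is_series_plus _ _ _ _ Sx
    (is_series_scal (V := R_NormedModule) mux _ _ Wx)) as Lx.
  change (is_series (fun j => lagrangian_term mux (x j)) (Vx + mux * (2 * rho))) in Lx.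
  apply (is_series_change_image _ x y i) in Lx; [|exact Hxy].
  pose proof (is_series_minus _ _ _ _ Lx
    (is_series_scal (V := R_NormedModule) mux _ _ Wy)) as Ly.
  pose proof (is_series_le _ _ _ _ Ly Sy) as H.
  unfold plus, opp, scal in H; simpl in H; unfold mult in H; simpl in H.
  pose proof (lagrangian_term_concave mux (y i) (x i) Hmx (Hy i) (Hx i)).
  assert (forall j, lagrangian_term mux (y j) + - (mux * log_excess muy (y j))
    <= Rmin muy (y j)).
  { intros j. now apply lagrangian_term_dual. }
  specialize (H H1). lra.
Qed.

Lemma residual_change_upper (x y : nat -> R) (i : nat) (rho mux muy Vx Vy : R) :
  (forall j, 0 < x j) -> (forall j, 0 < y j) -> (forall j, j <> i -> y j = x j) ->
  water_level x rho mux -> water_level y rho muy ->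
  is_series (fun j => Rmin mux (x j)) Vx -> is_series (fun j => Rmin muy (y j)) Vy ->
  Vy - Vx <= (y i - x i) * Rmin 1 (muy / x i).
Proof.
  intros Hx Hy Hxy Wx Wy Sx Sy.
  pose proof (residual_change_lower y x i rho muy mux Vy Vx Hy Hx
    (fun j Hj => eq_sym (Hxy j Hj)) Wy Wx Sy Sx). lra.
Qed.

(** * Stability of the water level and the quadratic error *)

Lemma log_excess_le (m m' x : R) :
  0 < m <= m' -> 0 < x -> log_excess m' x <= log_excess m x.
Proof.
  intros Hm Hx. unfold log_excess. rewrite !ln_div by lra.
  apply Rle_max_compat_l. assert (ln m <= ln m') by (apply ln_le; lra). lra.
Qed.

Lemma log_excess_lipschitz (m x y : R) :
  0 < m -> 0 < x -> 0 < y ->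
  Rabs (log_excess m y - log_excess m x) <= Rabs (ln y - ln x).
Proof.
  intros Hm Hx Hy. unfold log_excess. rewrite !ln_div by lra.
  unfold Rmax. repeat destruct (Rle_dec _ _);
    unfold Rabs; repeat destruct (Rcase_abs _); lra.
Qed.

(** In logarithms, changing component [i] alters the total excess by at most D = |ln(y i) - ln(x
    i)|. A move of the level by delta changes the excess of the active component [p] alone by delta,
    as long as [p] stays active, and no other component offsets this. Equal capacities force delta
    <= D. *)
Lemma water_level_stable (x y : nat -> R) (i p : nat) (rho mux muy : R) :
  (forall j, 0 < x j) -> (forall j, 0 < y j) -> (forall j, j <> i -> y j = x j) ->
  water_level x rho mux -> water_level y rho muy ->
  mux < x p -> Rabs (ln (y i) - ln (x i)) < ln (x p) - ln mux ->
  Rabs (ln muy - ln mux) <= Rabs (ln (y i) - ln (x i)).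
Proof.
  intros Hx Hy Hxy Wx Wy Hp HD.
  apply water_level_log_excess in Wx. apply water_level_log_excess in Wy.
  destruct Wx as [Hmx Wx]. destruct Wy as [Hmy Wy].
  apply (is_series_change_image _ y x i) in Wy; [|intros; symmetry; auto].
  pose proof (log_excess_lipschitz muy (y i) (x i) Hmy (Hy i) (Hx i)) as HL.
  rewrite Rabs_minus_sym in HD |- *. rewrite (Rabs_minus_sym (ln (y i))).
  set (D := Rabs (ln (x i) - ln (y i))) in *.
  apply Rabs_le_between in HL.
  destruct (Rle_dec mux muy) as [Hle|Hle].
  - assert (H : ln mux <= ln muy) by (apply ln_le; lra).
    rewrite Rabs_left1 by lra.
    pose proof (is_series_le_at _ _ _ _ (Rmin (ln (x p) - ln mux) (ln muy - ln mux)) p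
      Wy Wx (fun j => log_excess_le mux muy (x j) (conj Hmx Hle) (Hx j))) as Hs.
    (* The minimum allows for a level that rises past [x p]; [HD] then rules out that its first
       argument is the smaller one. *)
    assert (Hs' : Rmin (ln (x p) - ln mux) (ln muy - ln mux) <= D).
    { apply Rplus_le_reg_l with
        (2 * rho + (log_excess muy (x i) - log_excess muy (y i))).
      eapply Rle_trans; [apply Hs|lra].
      rewrite (log_excess_high mux) by lra.
      destruct (Rle_dec muy (x p)) as [Hc|Hc].
      - rewrite log_excess_high by lra.
        pose proof (Rmin_r (ln (x p) - ln mux) (ln muy - ln mux)). lra.
      - rewrite log_excess_low by (specialize (Hx p); lra).
        pose proof (Rmin_l (ln (x p) - ln mux) (ln muy - ln mux)). lra. }
    unfold Rmin in Hs'. destruct (Rle_dec _ _) in Hs'; lra.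
  - assert (H : ln muy <= ln mux) by (apply ln_le; lra).
    rewrite Rabs_right by lra.
    pose proof (is_series_le_at _ _ _ _ (ln mux - ln muy) p
      Wx Wy (fun j => log_excess_le muy mux (x j) (conj Hmy (Rlt_le _ _ (Rnot_le_lt _ _ Hle))) (Hx j))) as Hs.
    cbv beta in Hs. rewrite (log_excess_high mux (x p)), (log_excess_high muy (x p)) in Hs by lra.
    specialize (Hs ltac:(lra)). lra.
Qed.

(** With s = |t|, concavity of the logarithm makes the decrease by s the worst case, so b/a and a/b
    are at most l / (l - s). The condition s <= l/2 turns this into the factor 2. *)
Lemma ln_close_bound (a b l t : R) :
  0 < a -> 0 < b -> 0 < l -> Rabs t <= l / 2 ->
  Rabs (ln b - ln a) <= Rabs (ln (l + t) - ln l) -> Rabs (b - a) <= 2 * a * (Rabs t / l).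
Proof.
  intros Ha Hb Hl Ht H.
  assert (Ht' : 0 < l + t /\ 0 < l + Rabs t /\ 0 < l - Rabs t).
  { pose proof (Rabs_pos t). apply Rabs_le_between in Ht as Ht2. lra. }
  assert (Hu : Rabs (ln (l + t) - ln l) <= ln l - ln (l - Rabs t)).
  { destruct (Rle_dec 0 t) as [H0|H0].
    - rewrite (Rabs_right t) in * by lra.
      assert (ln l <= ln (l + t)) by (apply ln_le; lra).
      rewrite Rabs_right by lra.
      assert (ln (l + t) + ln (l - t) <= ln l + ln l); [|lra].
      rewrite <- !ln_mult by lra. apply ln_le; [apply Rmult_lt_0_compat; lra|].
      pose proof (Rle_0_sqr t). unfold Rsqr in *. lra.
    - rewrite (Rabs_left t) in * by lra.
      assert (ln (l + t) <= ln l) by (apply ln_le; lra).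
      rewrite Rabs_left1 by lra. replace (l - - t) with (l + t) by ring. lra. }
  set (s := Rabs t) in *. assert (0 <= s) by apply Rabs_pos.
  assert (H' := Rle_trans _ _ _ H Hu). apply Rabs_le_between in H'.
  assert (B1 : b * (l - s) <= a * l).
  { destruct (Rle_dec (b * (l - s)) (a * l)) as [|Hn]; [assumption|].
    apply Rnot_le_lt in Hn. apply ln_increasing in Hn; [|apply Rmult_lt_0_compat; lra].
    rewrite !ln_mult in Hn by lra. lra. }
  assert (B2 : a * (l - s) <= b * l).
  { destruct (Rle_dec (a * (l - s)) (b * l)) as [|Hn]; [assumption|].
    apply Rnot_le_lt in Hn. apply ln_increasing in Hn; [|apply Rmult_lt_0_compat; lra].
    rewrite !ln_mult in Hn by lra. lra. }
  replace (2 * a * (s / l)) with (2 * a * s / l) by (field; lra).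
  apply Rcomplements.Rle_div_r; [lra|].
  assert (0 <= a * s) by (apply Rmult_le_pos; lra).
  unfold Rabs. destruct (Rcase_abs (b - a)); [nra|].
  assert (b <= 2 * a) by nra. nra.
Qed.

Lemma Rmin_1_lipschitz (u v : R) : Rabs (Rmin 1 u - Rmin 1 v) <= Rabs (u - v).
Proof.
  unfold Rmin. repeat destruct (Rle_dec _ _);
    unfold Rabs; repeat destruct (Rcase_abs _); lra.
Qed.

(** Each slope of the sandwich is within K |t| of min(1, mux / x i): one because the level moves by
    O(|t|), the other because [y i] is at least half of [x i]. Since min(1, .) is 1-Lipschitz, the
    kink at [x i = mux] needs no separate treatment. *)
Lemma residual_change_quadratic (x y : nat -> R) (i p : nat)
    (rho mux muy Vx Vy : R) :
  (forall j, 0 < x j) -> (forall j, 0 < y j) -> (forall j, j <> i -> y j = x j) ->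
  water_level x rho mux -> water_level y rho muy ->
  is_series (fun j => Rmin mux (x j)) Vx -> is_series (fun j => Rmin muy (y j)) Vy ->
  mux < x p -> Rabs (y i - x i) <= x i / 2 ->
  Rabs (ln (y i) - ln (x i)) < ln (x p) - ln mux ->
  Rabs (Vy - Vx - (y i - x i) * Rmin 1 (mux / x i)) <=
  2 * mux / (x i * x i) * (Rabs (y i - x i) * Rabs (y i - x i)).
Proof.
  intros Hx Hy Hxy Wx Wy Sx Sy Hp Ht HD.
  pose proof (residual_change_lower x y i rho mux muy Vx Vy Hx Hy Hxy Wx Wy Sx Sy) as L.
  pose proof (residual_change_upper x y i rho mux muy Vx Vy Hx Hy Hxy Wx Wy Sx Sy) as U.
  pose proof (water_level_stable x y i p rho mux muy Hx Hy Hxy Wx Wy Hp HD) as W.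
  destruct Wx as [Hmx _]. destruct Wy as [Hmy _].
  set (t := y i - x i) in *. pose proof (Hx i) as Hxi. pose proof (Hy i) as Hyi.
  replace (y i) with (x i + t) in * by (unfold t; ring).
  pose proof (ln_close_bound mux muy (x i) t Hmx Hmy Hxi Ht W) as B.
  set (l := x i) in *. set (K := 2 * mux / (l * l)).
  assert (E1 : Rabs (Rmin 1 (muy / l) - Rmin 1 (mux / l)) <= K * Rabs t).
  { eapply Rle_trans; [apply Rmin_1_lipschitz|].
    replace (muy / l - mux / l) with ((muy - mux) / l) by (field; lra).
    rewrite Rabs_div, (Rabs_right l) by lra.
    replace (K * Rabs t) with (2 * mux * (Rabs t / l) / l) by (unfold K; field; lra).
    apply Rmult_le_compat_r; [left; now apply Rinv_0_lt_compat|exact B]. }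
  assert (E2 : Rabs (Rmin 1 (mux / (l + t)) - Rmin 1 (mux / l)) <= K * Rabs t).
  { eapply Rle_trans; [apply Rmin_1_lipschitz|].
    replace (mux / (l + t) - mux / l) with (mux * (- t) / (l * (l + t))) by (field; lra).
    assert (0 < l * (l + t)) by (apply Rmult_lt_0_compat; lra).
    rewrite Rabs_div, Rabs_mult, Rabs_Ropp, (Rabs_right mux), (Rabs_right (l * _)) by lra.
    apply Rcomplements.Rle_div_l; [lra|].
    replace (K * Rabs t * (l * (l + t))) with (mux * Rabs t * (2 * (l + t) / l))
      by (unfold K; field; lra).
    rewrite <- (Rmult_1_r (mux * Rabs t)) at 1.
    apply Rmult_le_compat_l; [apply Rmult_le_pos; [lra|apply Rabs_pos]|].
    apply Rcomplements.Rle_div_r; [lra|].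
    apply Rabs_le_between in Ht. lra. }
  apply Rabs_le_between in E1. apply Rabs_le_between in E2.
  set (m1 := Rmin 1 (muy / l)) in *. set (m2 := Rmin 1 (mux / (l + t))) in *.
  set (m0 := Rmin 1 (mux / l)) in *.
  apply Rabs_le_between. unfold Rabs in *. destruct (Rcase_abs t); nra.
Qed.

(** * From an ordered spectrum to the sum of minima *)

(** In a nonincreasing sequence the active indices form an initial segment; comparing the
    duplicate-free list with [seq] by length identifies it. *)
Lemma active_count_iff (lam : nat -> R) (mu : R) (n : nat) :
  (forall i, lam (S i) <= lam i) -> active_count lam mu n ->
  forall k, (k < n)%nat <-> mu < lam k.
Proof.
  intros Hdec (s & Hnd & Hlen & Hs) k.
  assert (Hmono : forall a b, (a <= b)%nat -> lam b <= lam a).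
  { intros a b Hab. induction Hab as [|b Hab IH]; [lra|].
    specialize (Hdec b). lra. }
  split; intros Hk.
  - apply Rnot_le_lt. intros Hle.
    assert (Hincl : incl s (seq 0 k)).
    { intros j Hj. apply Hs in Hj. apply in_seq.
      destruct (Nat.le_gt_cases k j) as [H|H]; [|lia].
      specialize (Hmono k j H). lra. }
    apply NoDup_incl_length in Hincl; [|exact Hnd].
    rewrite length_seq in Hincl. lia.
  - assert (Hincl : incl (seq 0 (S k)) s).
    { intros j Hj. apply in_seq in Hj. apply Hs.
      specialize (Hmono j k ltac:(lia)). lra. }
    apply NoDup_incl_length in Hincl; [|apply seq_NoDup].
    rewrite length_seq in Hincl. lia.
Qed.

(** The right-hand form ignores the order of [lam], so [eigenbasis_series] can carry it to another
    eigenbasis. *)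
Lemma residual_variance_series (lam : nat -> R) (mu : R) (n : nat) :
  (forall i, lam (S i) <= lam i) -> ex_series lam -> active_count lam mu n ->
  is_series (fun j => Rmin mu (lam j)) (residual_variance lam mu n).
Proof.
  intros Hdec Hex Hn. pose proof (active_count_iff lam mu n Hdec Hn) as Hiff.
  assert (Htail : is_series (fun k => Rmin mu (lam (n + k)%nat))
    (Series (fun k => lam (n + k)%nat))).
  { apply (is_series_ext (fun k => lam (n + k)%nat)).
    - intros k. symmetry. apply Rmin_right. apply Rnot_lt_le. intros H.
      apply Hiff in H. lia.
    - apply Series_correct. now apply ex_series_incr_n. }
  unfold residual_variance. destruct n as [|n].
  - simpl INR. rewrite Rmult_0_l, Rplus_0_l. exact Htail.
  - apply (is_series_decr_n _ (S n)); [lia|].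
    rewrite (sum_n_ext_loc _ (fun _ => mu)).
    + rewrite sum_n_const. simpl Init.Nat.pred.
      replace (plus _ _) with (Series (fun k => lam (S n + k)%nat)); [exact Htail|].
      unfold plus, opp; simpl. ring.
    + intros k Hk. apply Rmin_left. left. apply Hiff. simpl in Hk. lia.
Qed.

Lemma water_level_below_top (lam : nat -> R) (rho mu : R) :
  (forall i, 0 < lam i) -> (forall i, lam (S i) <= lam i) -> 0 < rho ->
  water_level lam rho mu -> mu < lam 0%nat.
Proof.
  intros Hpos Hdec Hrho W. apply water_level_log_excess in W. destruct W as [Hmu W].
  apply Rnot_le_lt. intros Hle.
  assert (Htop : forall j, lam j <= lam 0%nat).
  { induction j as [|j IH]; [lra|]. specialize (Hdec j). lra. }
  pose proof (is_series_le _ _ _ _ W is_series_zero) as H.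
  enough (2 * rho <= 0) by lra. apply H. intros j.
  rewrite log_excess_low; [lra|]. specialize (Hpos j). specialize (Htop j). lra.
Qed.

Lemma water_level_decreasing (lam : nat -> R) (rho rho' mu mu' : R) :
  (forall i, 0 < lam i) -> water_level lam rho mu -> water_level lam rho' mu' ->
  rho < rho' -> mu' < mu.
Proof.
  intros Hpos W W' Hlt. apply water_level_log_excess in W, W'.
  destruct W as [Hmu W]. destruct W' as [Hmu' W'].
  apply Rnot_le_lt. intros Hle.
  pose proof (is_series_le _ _ _ _ W' W
    (fun j => log_excess_le mu mu' (lam j) (conj Hmu Hle) (Hpos j))). lra.
Qed.

(** * The optimal team size as a function of V / S *)

Lemma is_derive_linear_error (f : R -> R) (x l : R) :
  is_derive f x l <-> forall eps, 0 < eps ->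
    locally x (fun y => Rabs (f y - f x - l * (y - x)) <= eps * Rabs (y - x)).
Proof.
  split.
  - intros [_ H] eps Heps.
    specialize (H x (fun P HP => HP) (mkposreal eps Heps)).
    revert H. apply filter_imp. intros y Hy.
    unfold norm, minus, plus, opp, scal in Hy; simpl in Hy.
    unfold abs, mult in Hy; simpl in Hy.
    replace (f y - f x - l * (y - x)) with (f y + - f x + - ((y + - x) * l)) by ring.
    exact Hy.
  - intros H. split; [apply is_linear_scal_l|].
    intros z Hz eps. rewrite <- (is_filter_lim_locally_unique x z Hz).
    generalize (H eps (cond_pos eps)). apply filter_imp. intros y Hy.
    unfold norm, minus, plus, opp, scal; simpl. unfold abs, mult; simpl.
    replace (f y + - f x + - ((y + - x) * l)) with (f y - f x - l * (y - x)) by ring.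
    exact Hy.
Qed.

Lemma is_derive_quadratic_error (f : R -> R) (x l K : R) :
  locally x (fun y => Rabs (f y - f x - l * (y - x)) <= K * (Rabs (y - x) * Rabs (y - x))) ->
  is_derive f x l.
Proof.
  intros H. apply is_derive_linear_error. intros eps Heps.
  assert (HK : 0 < eps / (Rabs K + 1)).
  { apply Rdiv_lt_0_compat; [exact Heps|]. pose proof (Rabs_pos K). lra. }
  assert (Hb : locally x (fun y => Rabs (y - x) < eps / (Rabs K + 1)))
    by (now exists (mkposreal _ HK)).
  generalize (filter_and _ _ H Hb). apply filter_imp. intros y [H1 H2].
  eapply Rle_trans; [exact H1|]. rewrite <- Rmult_assoc.
  apply Rmult_le_compat_r; [apply Rabs_pos|].
  apply Rle_trans with ((Rabs K + 1) * Rabs (y - x)).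
  - apply Rmult_le_compat_r; [apply Rabs_pos|]. pose proof (Rle_abs K). lra.
  - rewrite Rmult_comm. pose proof (Rabs_pos K).
    apply Rcomplements.Rle_div_r; lra.
Qed.

Lemma D_in_linear_error (f f' : R -> R) (D : R -> Prop) (x : R) :
  D_in f f' D x -> forall eps, 0 < eps -> exists delta, 0 < delta /\
    forall y, D y -> Rabs (y - x) < delta ->
      Rabs (f y - f x - f' x * (y - x)) <= eps * Rabs (y - x).
Proof.
  intros H eps Heps. destruct (H eps Heps) as [delta [Hd Hdelta]].
  exists delta. split; [exact Hd|]. intros y Dy Hy.
  destruct (Req_dec y x) as [->|Hne].
  - replace (f x - f x - f' x * (x - x)) with 0 by ring.
    rewrite Rminus_diag, Rabs_R0. lra.
  - specialize (Hdelta y (conj (conj Dy (not_eq_sym Hne)) Hy)). simpl in Hdelta.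
    unfold Rdist in Hdelta.
    replace (f y - f x - f' x * (y - x)) with (((f y - f x) / (y - x) - f' x) * (y - x))
      by (field; lra).
    rewrite Rabs_mult. apply Rmult_le_compat_r; [apply Rabs_pos|]. now left.
Qed.

Lemma is_derive_D_in (f f' : R -> R) (D : R -> Prop) (x : R) :
  is_derive f x (f' x) -> D_in f f' D x.
Proof.
  intros H. apply is_derive_Reals in H. apply derivable_pt_lim_D_in in H.
  intros eps Heps. destruct (H eps Heps) as [d [Hd Hx]]. exists d. split; [exact Hd|].
  intros y [[_ Hne] Hy]. apply Hx. now repeat split.
Qed.

Lemma D_in_is_derive (f f' : R -> R) (x : R) :
  1 < x -> D_in f f' team_sizes x -> is_derive f x (f' x).
Proof.
  intros Hx H. apply is_derive_linear_error. intros eps Heps.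
  destruct (D_in_linear_error _ _ _ _ H eps Heps) as [d [Hd Hy]].
  assert (Hd' : 0 < Rmin d (x - 1)) by (apply Rmin_pos; lra).
  exists (mkposreal _ Hd'). intros y Hb. simpl in Hb.
  assert (Hb1 : Rabs (y - x) < Rmin d (x - 1)) by exact Hb.
  pose proof (Rmin_l d (x - 1)). pose proof (Rmin_r d (x - 1)).
  apply Hy; [|lra]. unfold team_sizes.
  assert (Hb2 : Rabs (y - x) < x - 1) by lra. apply Rabs_lt_between in Hb2. lra.
Qed.

Lemma Rle_of_eps (a b c : R) : 0 <= c -> (forall eps, 0 < eps -> a <= b + eps * c) -> a <= b.
Proof.
  intros Hc H. apply Rnot_lt_le. intros Hlt.
  assert (He : 0 < (a - b) / (2 * (c + 1))) by (apply Rdiv_lt_0_compat; lra).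
  specialize (H _ He).
  assert (E : (a - b) / (2 * (c + 1)) * (c + 1) = (a - b) / 2) by (field; lra).
  rewrite Rmult_plus_distr_l in E. lra.
Qed.

(** On the segment from [x] towards [y], convexity bounds the increment of [f] after a fraction s by
    s (f y - f x), while the derivative predicts s f'(x) (y - x) up to [eps]. One-sided derivatives
    suffice, since the segment stays in the domain. *)
Lemma convex_on_tangent (f f' : R -> R) (x y : R) :
  convex_on team_sizes f -> team_sizes x -> team_sizes y -> D_in f f' team_sizes x ->
  f' x * (y - x) <= f y - f x.
Proof.
  intros Hc Hx Hy Hd. apply Rle_of_eps with (Rabs (y - x)); [apply Rabs_pos|].
  intros eps Heps. destruct (D_in_linear_error _ _ _ _ Hd eps Heps) as [d [Hdpos Herr]].
  pose proof (Rabs_pos (y - x)) as Hn.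
  (* Small enough to bring [z] strictly within [d] of [x]; the added 1 covers [y = x]. *)
  pose (s := Rmin 1 (d / (2 * (Rabs (y - x) + 1)))).
  assert (Hs0 : 0 < s) by (apply Rmin_pos; [lra|apply Rdiv_lt_0_compat; lra]).
  assert (Hs1 : s <= 1) by apply Rmin_l.
  assert (Hs2 : s * (2 * (Rabs (y - x) + 1)) <= d).
  { apply Rcomplements.Rle_div_r; [lra|]. apply Rmin_r. }
  pose (z := s * y + (1 - s) * x).
  assert (Hz : z - x = s * (y - x)) by (unfold z; ring).
  assert (HzD : team_sizes z) by (unfold team_sizes, z in *; nra).
  assert (Habs : Rabs (z - x) = s * Rabs (y - x)).
  { rewrite Hz, Rabs_mult, (Rabs_right s); lra. }
  specialize (Herr z HzD ltac:(rewrite Habs; nra)).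
  rewrite Habs, Hz in Herr. apply Rabs_le_between in Herr.
  pose proof (Hc y x s Hy Hx ltac:(lra)) as H. fold z in H.
  apply Rmult_le_reg_l with s; [exact Hs0|]. lra.
Qed.

Lemma convex_on_derivative_monotone (f f' : R -> R) (x y : R) :
  convex_on team_sizes f -> (forall k, team_sizes k -> D_in f f' team_sizes k) ->
  1 <= x <= y -> f' x <= f' y.
Proof.
  intros Hc Hd Hxy.
  assert (Hx : team_sizes x) by (unfold team_sizes; lra).
  assert (Hy : team_sizes y) by (unfold team_sizes; lra).
  destruct (Req_dec x y) as [->|Hne]; [lra|].
  pose proof (convex_on_tangent f f' x y Hc Hx Hy (Hd x Hx)).
  pose proof (convex_on_tangent f f' y x Hc Hy Hx (Hd y Hy)).
  apply Rmult_le_reg_r with (y - x); lra.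
Qed.

(** [smooth_on] brings its own derivatives [F]. Uniqueness of the derivative identifies [F 1] with
    [f'] at interior points, and hence [F 2] is the derivative of [f'] there. *)
Lemma smooth_derivative_differentiable (f f' : R -> R) (k : R) :
  smooth_on team_sizes f -> (forall k, team_sizes k -> D_in f f' team_sizes k) ->
  1 < k -> exists f2, is_derive f' k f2.
Proof.
  intros (F & HF0 & HF) Hd Hk.
  assert (Hloc : forall k, 1 < k -> locally k (fun z => 1 < z)).
  { intros z Hz. exact (open_gt 1 z Hz). }
  assert (E : forall z, 1 < z -> F 1%nat z = f' z).
  { intros z Hz. assert (Dz : team_sizes z) by (unfold team_sizes; lra).
    pose proof (D_in_is_derive _ _ z Hz (Hd z Dz)) as H1.
    pose proof (D_in_is_derive _ _ z Hz (HF 0%nat z Dz)) as H2.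
    rewrite <- (is_derive_unique _ _ _ H1), <- (is_derive_unique _ _ _ H2).
    apply Derive_ext_loc. generalize (Hloc z Hz). apply filter_imp.
    intros w Hw. apply HF0. unfold team_sizes. lra. }
  exists (F 2%nat k). apply is_derive_ext_loc with (F 1%nat).
  - generalize (Hloc k Hk). apply filter_imp. exact E.
  - apply D_in_is_derive; [exact Hk|]. apply HF. unfold team_sizes. lra.
Qed.

Lemma D_in_minimum_right (L L' : R -> R) (k : R) :
  team_sizes k -> D_in L L' team_sizes k ->
  (forall y, team_sizes y -> L k <= L y) -> 0 <= L' k.
Proof.
  intros Hk HD Hmin. apply Rle_of_eps with 1; [lra|]. intros eps Heps.
  destruct (D_in_linear_error _ _ _ _ HD eps Heps) as [d [Hd Herr]].
  assert (Hy : team_sizes (k + d / 2)) by (unfold team_sizes in *; lra).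
  specialize (Herr (k + d / 2) Hy). specialize (Hmin _ Hy).
  replace (k + d / 2 - k) with (d / 2) in Herr by ring.
  rewrite (Rabs_right (d / 2)) in Herr by lra. specialize (Herr ltac:(lra)).
  apply Rabs_le_between in Herr.
  apply Rmult_le_reg_r with (d / 2); lra.
Qed.

Lemma D_in_minimum_interior (L L' : R -> R) (k : R) :
  1 < k -> D_in L L' team_sizes k ->
  (forall y, team_sizes y -> L k <= L y) -> L' k = 0.
Proof.
  intros Hk HD Hmin. apply Rle_antisym.
  - apply Rle_of_eps with 1; [lra|]. intros eps Heps.
    destruct (D_in_linear_error _ _ _ _ HD eps Heps) as [d [Hd Herr]].
    pose (h := Rmin (d / 2) (k - 1)).
    assert (Hh : 0 < h) by (apply Rmin_pos; lra).
    assert (Hh1 : h <= d / 2) by apply Rmin_l.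
    assert (Hh2 : h <= k - 1) by apply Rmin_r.
    assert (Hy : team_sizes (k - h)) by (unfold team_sizes in *; lra).
    specialize (Herr (k - h) Hy). specialize (Hmin _ Hy).
    replace (k - h - k) with (- h) in Herr by ring.
    rewrite (Rabs_left (- h)) in Herr by lra. specialize (Herr ltac:(lra)).
    apply Rabs_le_between in Herr. apply Rmult_le_reg_r with h; lra.
  - apply (D_in_minimum_right L L' k); auto. unfold team_sizes; lra.
Qed.

(** * The first-order condition and its inversion *)

Definition marginal_ratio (f' : R -> R) (k : R) : R := 2 * (k * k) * f' k.

Lemma first_order_condition (f f' : R -> R) (V S k : R) :
  (forall k, team_sizes k -> D_in f f' team_sizes k) -> 0 < S -> 2 * f' 1 < V / S ->
  team_sizes k ->
  (forall y, team_sizes y -> / (4 * k) * V + f k / 2 * S <= / (4 * y) * V + f y / 2 * S) ->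
  1 < k /\ marginal_ratio f' k = V / S.
Proof.
  intros Hd HS HV Hk Hmin.
  pose (L := fun y => V * / (4 * y) + S / 2 * f y).
  pose (L' := fun y => V * (- / (4 * (y * y))) + S / 2 * f' y).
  assert (Hk0 : 1 <= k) by exact Hk.
  assert (HL : D_in L L' team_sizes k).
  { apply (Dadd team_sizes (fun y => V * (- / (4 * (y * y)))) (fun y => S / 2 * f' y)
      (fun y => V * / (4 * y))).
    - apply Dmult_const, is_derive_D_in. auto_derive; [lra|]. field. lra.
    - apply Dmult_const, Hd, Hk. }
  assert (HLmin : forall y, team_sizes y -> L k <= L y).
  { intros y Hy. specialize (Hmin y Hy). unfold L. lra. }
  assert (HV' : 2 * f' 1 * S < V) by (apply Rcomplements.Rlt_div_r; lra).
  (* A minimum at the left end requires a nonnegative derivative, but at 1 it equals (2 f'(1) S - V)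
     / 4 < 0. *)
  assert (Hk1 : 1 < k).
  { destruct (Req_dec k 1) as [->|Hne]; [|lra].
    pose proof (D_in_minimum_right L L' 1 Hk HL HLmin) as H. unfold L' in H.
    replace (/ (4 * (1 * 1))) with (/ 4) in H by (f_equal; ring). lra. }
  split; [exact Hk1|].
  pose proof (D_in_minimum_interior L L' k Hk1 HL HLmin) as H. unfold L' in H.
  unfold marginal_ratio. apply Rmult_eq_reg_r with S; [|lra].
  replace (V / S * S) with V by (field; lra).
  assert (E : (V * - / (4 * (k * k)) + S / 2 * f' k) * (4 * (k * k)) = 0)
    by (rewrite H; ring).
  replace ((V * - / (4 * (k * k)) + S / 2 * f' k) * (4 * (k * k)))
    with (- V + S / 2 * f' k * (4 * (k * k))) in E by (field; lra).
  lra.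
Qed.

(** By convexity f'(y) >= f'(x) >= f'(1), and y^2 - x^2 >= 2 (y - x) on [1,+oo). The three
    assertions are the nonnegative remainders of these estimates. *)
Lemma marginal_ratio_growth (f f' : R -> R) (x y : R) :
  convex_on team_sizes f -> (forall k, team_sizes k -> D_in f f' team_sizes k) ->
  0 < f' 1 -> 1 <= x <= y ->
  4 * f' 1 * (y - x) <= marginal_ratio f' y - marginal_ratio f' x.
Proof.
  intros Hc Hd Hf1 Hxy. unfold marginal_ratio.
  pose proof (convex_on_derivative_monotone f f' x y Hc Hd Hxy).
  pose proof (convex_on_derivative_monotone f f' 1 x Hc Hd ltac:(lra)).
  assert (0 <= 2 * (y * y) * (f' y - f' x)) by (apply Rmult_le_pos; nra).
  assert (0 <= 2 * ((y - x) * (y + x)) * (f' x - f' 1)) by (apply Rmult_le_pos; nra).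
  assert (0 <= 2 * (y - x) * (y + x - 2) * f' 1).
  { apply Rmult_le_pos; [|lra]. apply Rmult_le_pos; nra. }
  nra.
Qed.

Lemma marginal_ratio_expansive (f f' : R -> R) (x y : R) :
  convex_on team_sizes f -> (forall k, team_sizes k -> D_in f f' team_sizes k) ->
  0 < f' 1 -> 1 <= x -> 1 <= y ->
  4 * f' 1 * Rabs (y - x) <= Rabs (marginal_ratio f' y - marginal_ratio f' x).
Proof.
  intros Hc Hd Hf1 Hx Hy. destruct (Rle_dec x y) as [Hle|Hle].
  - rewrite (Rabs_right (y - x)) by lra.
    eapply Rle_trans; [|apply Rle_abs]. apply (marginal_ratio_growth f); auto.
  - rewrite (Rabs_minus_sym y), (Rabs_minus_sym (marginal_ratio f' y)),
      (Rabs_right (x - y)) by lra.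
    eapply Rle_trans; [|apply Rle_abs]. apply (marginal_ratio_growth f); auto; lra.
Qed.

(** Smoothness gives the existence of the derivative; the growth bound forces it to be at least 4
    f'(1). *)
Lemma marginal_ratio_derivative (f f' : R -> R) (k : R) :
  convex_on team_sizes f -> smooth_on team_sizes f ->
  (forall k, team_sizes k -> D_in f f' team_sizes k) -> 0 < f' 1 -> 1 < k ->
  exists g, 0 < g /\ is_derive (marginal_ratio f') k g.
Proof.
  intros Hc Hs Hd Hf1 Hk.
  destruct (smooth_derivative_differentiable f f' k Hs Hd Hk) as [f2 Hf2].
  assert (HG : is_derive (marginal_ratio f') k (4 * k * f' k + 2 * (k * k) * f2)).
  { unfold marginal_ratio. auto_derive.
    - exists f2. exact Hf2.
    - replace (Derive (fun x => f' x) k) with f2 by (symmetry; now apply is_derive_unique).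
      ring. }
  set (g := 4 * k * f' k + 2 * (k * k) * f2) in *.
  exists g. split; [|exact HG].
  apply Rlt_le_trans with (4 * f' 1); [lra|].
  apply Rle_of_eps with 1; [lra|]. intros eps Heps.
  pose proof (proj1 (is_derive_linear_error _ _ _) HG eps Heps) as [d Herr].
  pose proof (cond_pos d) as Hdpos.
  specialize (Herr (k + d / 2)).
  replace (k + d / 2 - k) with (d / 2) in Herr by ring.
  rewrite (Rabs_right (d / 2)) in Herr by lra.
  assert (Hb : ball k d (k + d / 2)).
  { change (Rabs (k + d / 2 - k) < d). replace (k + d / 2 - k) with (d / 2) by ring.
    rewrite Rabs_right; lra. }
  specialize (Herr Hb). apply Rabs_le_between in Herr.
  pose proof (marginal_ratio_growth f f' k (k + d / 2) Hc Hd Hf1 ltac:(lra)).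
  apply Rmult_le_reg_r with (d / 2); lra.
Qed.

(** The chain rule solved for the inner function, whose differentiability is the conclusion. The
    expansion bound makes [k] Lipschitz at [t0], so the linearization error of [G] at [k t0] is also
    small relative to t - t0; subtracting it from that of G(k(t)) leaves g (k(t) - k(t0)) - q (t -
    t0). *)
Lemma is_derive_inverse_along (G k : R -> R) (t0 g q c : R) :
  is_derive G (k t0) g -> g <> 0 -> is_derive (fun t => G (k t)) t0 q -> 0 < c ->
  locally t0 (fun t => c * Rabs (k t - k t0) <= Rabs (G (k t) - G (k t0))) ->
  is_derive k t0 (q / g).
Proof.
  intros HG Hg Hq Hc Hexp.
  pose proof (proj1 (is_derive_linear_error _ _ _) HG) as EG.
  pose proof (proj1 (is_derive_linear_error _ _ _) Hq) as Eq.
  (* The Lipschitz constant of [k] at [t0], from the linearization of G(k(t)) with tolerance 1. *)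
  pose (C := (Rabs q + 1) / c).
  assert (HC : 0 < C).
  { apply Rdiv_lt_0_compat; [|exact Hc]. pose proof (Rabs_pos q). lra. }
  assert (Hlip : locally t0 (fun t => Rabs (k t - k t0) <= C * Rabs (t - t0))).
  { generalize (filter_and _ _ Hexp (Eq 1 Rlt_0_1)). apply filter_imp. intros t [H1 H2].
    replace (C * Rabs (t - t0)) with ((Rabs q + 1) * Rabs (t - t0) / c)
      by (unfold C; field; lra).
    apply Rcomplements.Rle_div_r; [exact Hc|]. rewrite Rmult_comm.
    eapply Rle_trans; [exact H1|].
    replace (G (k t) - G (k t0))
      with ((G (k t) - G (k t0) - q * (t - t0)) + q * (t - t0)) by ring.
    eapply Rle_trans; [apply Rabs_triang|]. rewrite Rabs_mult. lra. }
  assert (Hg' : 0 < Rabs g) by now apply Rabs_pos_lt.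
  apply is_derive_linear_error. intros eps Heps.
  assert (He1 : 0 < eps * Rabs g / (2 * C)).
  { apply Rdiv_lt_0_compat; [|lra]. now apply Rmult_lt_0_compat. }
  assert (He2 : 0 < eps * Rabs g / 2).
  { apply Rdiv_lt_0_compat; [|lra]. now apply Rmult_lt_0_compat. }
  destruct (EG _ He1) as [d Hd].
  assert (Hr : 0 < d / (C + 1)).
  { apply Rdiv_lt_0_compat; [apply cond_pos|lra]. }
  assert (Hsmall : locally t0 (fun t => Rabs (t - t0) < d / (C + 1)))
    by (now exists (mkposreal _ Hr)).
  generalize (filter_and _ _ (filter_and _ _ Hlip Hsmall) (Eq _ He2)).
  apply filter_imp. intros t [[H1 H2] H3].
  apply Rcomplements.Rlt_div_r in H2; [|lra].
  pose proof (Rabs_pos (t - t0)) as Ht.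
  assert (Hb : ball (k t0) d (k t)).
  { change (Rabs (k t - k t0) < d). nra. }
  specialize (Hd (k t) Hb).
  apply Rmult_le_reg_l with (Rabs g); [exact Hg'|].
  rewrite <- Rabs_mult.
  replace (g * (k t - k t0 - q / g * (t - t0)))
    with ((G (k t) - G (k t0) - q * (t - t0)) - (G (k t) - G (k t0) - g * (k t - k t0)))
    by (field; exact Hg).
  eapply Rle_trans; [apply Rabs_triang|]. rewrite Rabs_Ropp.
  assert (H4 : eps * Rabs g / (2 * C) * Rabs (k t - k t0)
    <= eps * Rabs g / 2 * Rabs (t - t0)).
  { replace (eps * Rabs g / 2 * Rabs (t - t0))
      with (eps * Rabs g / (2 * C) * (C * Rabs (t - t0))) by (field; lra).
    apply Rmult_le_compat_l; lra. }
  lra.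
Qed.

(** * Perturbing one eigenvalue *)

(** A divergent series of nonnegative terms has limit [p_infty], whose [real] value is 0. *)
Lemma ex_series_of_Series_neq_0 (a : nat -> R) :
  (forall i, 0 <= a i) -> Series a <> 0 -> ex_series a.
Proof.
  intros Ha Hs.
  assert (Hl : ex_lim_seq (sum_n a)).
  { apply ex_lim_seq_incr. intros n. rewrite sum_n_S. specialize (Ha (S n)). lra. }
  apply Lim_seq_correct in Hl. unfold Series in Hs.
  destruct (Lim_seq (sum_n a)) as [s| |]; simpl in Hs; [|lra|lra].
  now exists s.
Qed.

Lemma shift_at_other (lam : nat -> R) (i : nat) (t : R) (j : nat) :
  j <> i -> shift_at lam i t j = lam j.
Proof. intros Hj. unfold shift_at. now rewrite (proj2 (Nat.eqb_neq j i) Hj). Qed.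

Lemma shift_at_same (lam : nat -> R) (i : nat) (t : R) :
  shift_at lam i t i = lam i + t.
Proof. unfold shift_at. now rewrite Nat.eqb_refl. Qed.

Lemma shift_at_pos (lam : nat -> R) (i : nat) (t : R) :
  (forall j, 0 < lam j) -> 0 < lam i + t -> forall j, 0 < shift_at lam i t j.
Proof. intros H Ht j. unfold shift_at. destruct (Nat.eqb_spec j i); auto. Qed.

(** Moves the optimality statement from the spectrum hidden in [optimal_team_size] to [shift_at], by
    using [eigenbasis_series] for the total variance, the capacity constraint and the sum of
    minima. *)
Lemma optimal_team_size_perturbed (C0 : R -> R -> R) (lam : nat -> R)
    (phi : nat -> R -> R) (f : R -> R) (rho k : R) (i : nat) (t : R) :
  covariance_kernel C0 -> positive_spectrum C0 lam phi -> ex_series lam ->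
  0 < lam i + t -> optimal_team_size (perturbed_kernel C0 (phi i) t) f rho k ->
  exists mu V : R, water_level (shift_at lam i t) rho mu /\
    is_series (fun j => Rmin mu (shift_at lam i t j)) V /\ team_sizes k /\
    forall y, team_sizes y ->
      / (4 * k) * V + f k / 2 * (Series lam + t) <=
      / (4 * y) * V + f y / 2 * (Series lam + t).
Proof.
  intros HC Hspec Hex Ht (lam' & phi' & mu & n & Hspec' & W & Hn & Hk & Hmin).
  pose proof (positive_spectrum_eigenbasis _ _ _ Hspec) as B0.
  pose proof (positive_spectrum_eigenbasis _ _ _ Hspec') as B'.
  assert (Hphi : continuous_on unit_interval (phi i)) by apply B0.
  assert (HCc : continuous_kernel C0) by apply HC.
  assert (Hc : continuous_kernel (perturbed_kernel C0 (phi i) t))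
    by now apply perturbed_kernel_continuous.
  assert (Hs : symmetric_kernel (perturbed_kernel C0 (phi i) t)).
  { intros x y Hx Hy. unfold perturbed_kernel.
    rewrite (kernel_symmetric _ HC x y Hx Hy). ring. }
  pose proof (perturbed_eigenbasis C0 lam phi i t HCc B0 Ht) as B.
  assert (Hsum : is_series (shift_at lam i t) (Series lam + t)).
  { replace t with (shift_at lam i t i - lam i) at 2 by (rewrite shift_at_same; ring).
    apply is_series_change_at.
    - intros j Hj. now apply shift_at_other.
    - now apply Series_correct. }
  pose proof (fun g s => eigenbasis_series _ _ _ _ _ g s Hs Hc B B'
    (ex_intro _ _ Hsum)) as Htransfer.
  assert (Hsum' : is_series lam' (Series lam + t))
    by (apply (Htransfer (fun x => x)); auto using Rlt_le).
  exists mu, (residual_variance lam' mu n). destruct W as [Hmu W].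
  split; [|split; [|split]].
  - split; [exact Hmu|]. apply (Htransfer (fun x => / 2 * Rmax 0 (ln (x / mu)))).
    + intros x _. pose proof (Rmax_l 0 (ln (x / mu))). lra.
    + exact W.
  - apply (Htransfer (Rmin mu)).
    + intros x Hx. apply Rmin_glb; lra.
    + apply residual_variance_series; [apply Hspec'|now exists (Series lam + t)|exact Hn].
  - exact Hk.
  - intros y Hy. specialize (Hmin y Hy). unfold total_loss in Hmin.
    now rewrite (is_series_unique _ _ Hsum') in Hmin.
Qed.

Lemma locally_0_small (P : R -> Prop) (d : R) :
  0 < d -> locally 0 P -> locally 0 (fun t => Rabs t < d /\ P t).
Proof.
  intros Hd HP. apply filter_and; [|exact HP].
  exists (mkposreal d Hd). intros t Ht.
  change (Rabs (t - 0) < d) in Ht. now rewrite Rminus_0_r in Ht.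
Qed.

Lemma ln_continuous_at (l : R) (e : R) :
  0 < l -> 0 < e -> locally 0 (fun t => Rabs (ln (l + t) - ln l) < e).
Proof.
  intros Hl He.
  assert (H : continuous (fun t => ln (l + t)) 0).
  { apply (ex_derive_continuous (K := R_AbsRing) (V := R_NormedModule)).
    auto_derive. lra. }
  assert (Hb : locally (ln (l + 0)) (fun z => Rabs (z - ln (l + 0)) < e))
    by (now exists (mkposreal e He)).
  specialize (H _ Hb). rewrite Rplus_0_r in H. exact H.
Qed.

Lemma optimal_team_size_near_0 (C0 : R -> R -> R) (lam : nat -> R)
    (phi : nat -> R -> R) (f f' : R -> R) (rho mu V : R) (k : R -> R) (i : nat) :
  covariance_kernel C0 -> positive_spectrum C0 lam phi -> ex_series lam ->
  (forall k, team_sizes k -> D_in f f' team_sizes k) -> 0 < f' 1 ->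
  0 < rho -> water_level lam rho mu -> is_series (fun j => Rmin mu (lam j)) V ->
  0 < Series lam -> 2 * f' 1 < V / Series lam ->
  locally 0 (fun t => 0 <= lam i + t ->
    optimal_team_size (perturbed_kernel C0 (phi i) t) f rho (k t)) ->
  exists K, locally 0 (fun t => 1 < k t /\ 0 < Series lam + t /\
    Rabs (marginal_ratio f' (k t) * (Series lam + t) - V - Rmin 1 (mu / lam i) * t)
    <= K * (Rabs t * Rabs t)).
Proof.
  intros HC Hspec Hex Hd Hf1 Hrho W SV HS Hgap Hopt.
  set (S := Series lam) in *.
  pose proof (spectrum_positive _ _ _ Hspec) as Hpos. pose proof (Hpos i) as Hi.
  assert (Htop : mu < lam 0%nat).
  { apply (water_level_below_top lam rho); auto. apply Hspec. }
  pose proof (proj1 W) as Hmu.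
  assert (Hln : ln mu < ln (lam 0%nat)) by (apply ln_increasing; lra).
  assert (Hgap' : 2 * f' 1 * S < V) by (apply Rcomplements.Rlt_div_r; lra).
  set (K := 2 * mu / (lam i * lam i)).
  assert (HK : 0 < K) by (apply Rdiv_lt_0_compat; nra).
  exists K.
  (* Keeps the optimum interior: for |t| < 1, V changes by at most (1 + K) |t| and 2 f'(1) S by at
     most 2 f'(1) |t|, so the gap stays open when |t| < eta. *)
  pose (eta := (V - 2 * f' 1 * S) / (2 + K + 2 * f' 1)).
  assert (Heta : 0 < eta) by (apply Rdiv_lt_0_compat; lra).
  pose proof (locally_0_small _ _ Heta (locally_0_small _ 1 Rlt_0_1
    (locally_0_small _ S HS (locally_0_small _ (lam i / 2) ltac:(lra)
    (filter_and _ _ Hopt (ln_continuous_at (lam i) (ln (lam 0%nat) - ln mu) Hi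
      ltac:(lra))))))) as Hloc.
  revert Hloc. apply filter_imp. intros t (T1 & T2 & T3 & T4 & Ht & T5).
  assert (Hit : 0 < lam i + t) by (apply Rabs_lt_between in T4; lra).
  assert (HSt : 0 < S + t) by (apply Rabs_lt_between in T3; lra).
  destruct (optimal_team_size_perturbed C0 lam phi f rho (k t) i t HC Hspec Hex Hit
    (Ht (Rlt_le _ _ Hit))) as (mut & Vt & Wt & SVt & Hk & Hmin).
  pose proof (residual_change_quadratic lam (shift_at lam i t) i 0 rho mu mut V Vt
    Hpos (shift_at_pos lam i t Hpos Hit)
    (fun j Hj => shift_at_other lam i t j Hj) W Wt SV SVt Htop) as Q.
  rewrite shift_at_same, Rplus_minus_l in Q.
  specialize (Q (Rlt_le _ _ T4) T5). fold K in Q.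
  assert (Hgapt : 2 * f' 1 < Vt / (S + t)).
  { apply (Rcomplements.Rlt_div_r (2 * f' 1) Vt (S + t)); [exact HSt|].
    unfold eta in T1. apply Rcomplements.Rlt_div_r in T1; [|lra].
    assert (Hm : 0 <= Rmin 1 (mu / lam i) <= 1).
    { split; [|apply Rmin_l]. apply Rmin_glb; [lra|].
      left. now apply Rdiv_lt_0_compat. }
    pose proof (Rabs_pos t) as Hat.
    assert (Hat2 : K * (Rabs t * Rabs t) <= K * Rabs t).
    { apply Rmult_le_compat_l; [lra|]. nra. }
    assert (Hmt : Rabs (t * Rmin 1 (mu / lam i)) <= Rabs t).
    { rewrite Rabs_mult, (Rabs_right (Rmin _ _)) by lra. nra. }
    assert (Hft : 2 * f' 1 * t <= 2 * f' 1 * Rabs t).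
    { apply Rmult_le_compat_l; [lra|apply Rle_abs]. }
    apply Rabs_le_between in Q. apply Rabs_le_between in Hmt. lra. }
  destruct (first_order_condition f f' Vt (S + t) (k t) Hd HSt Hgapt Hk Hmin)
    as [Hk1 Hfoc].
  repeat split; auto. rewrite Hfoc.
  replace (Vt / (S + t) * (S + t)) with Vt by (field; lra).
  now rewrite (Rmult_comm (Rmin _ _)).
Qed.

Lemma optimal_team_size_derivative (C0 : R -> R -> R) (lam : nat -> R)
    (phi : nat -> R -> R) (f f' : R -> R) (rho mu V : R) (k : R -> R) (i : nat) :
  covariance_kernel C0 -> positive_spectrum C0 lam phi -> ex_series lam ->
  adaptation_function f -> convex_on team_sizes f ->
  (forall k, team_sizes k -> D_in f f' team_sizes k) -> 0 < f' 1 ->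
  0 < rho -> water_level lam rho mu -> is_series (fun j => Rmin mu (lam j)) V ->
  0 < Series lam -> 2 * f' 1 < V / Series lam ->
  locally 0 (fun t => 0 <= lam i + t ->
    optimal_team_size (perturbed_kernel C0 (phi i) t) f rho (k t)) ->
  exists c, 0 < c /\ is_derive k 0 ((Rmin 1 (mu / lam i) - V / Series lam) * c).
Proof.
  intros HC Hspec Hex Hf Hconv Hd Hf1 Hrho W SV HS Hgap Hopt.
  destruct (optimal_team_size_near_0 C0 lam phi f f' rho mu V k i) as [K Hloc]; auto.
  set (S := Series lam) in *. set (m := Rmin 1 (mu / lam i)) in *.
  (* By the first-order condition [F t] is the residual variance after the perturbation, recovered
     from [k] itself. *)
  pose (F := fun t => marginal_ratio f' (k t) * (S + t)).
  destruct (locally_singleton _ _ Hloc) as (Hk0 & _ & H0).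
  assert (F0 : F 0 = V).
  { rewrite Rabs_R0 in H0. replace (K * (0 * 0)) with 0 in H0 by ring.
    apply Rabs_le_between in H0. unfold F. lra. }
  assert (HF : is_derive F 0 m).
  { apply is_derive_quadratic_error with K. revert Hloc. apply filter_imp.
    intros t (_ & _ & Ht). rewrite F0, !Rminus_0_r. exact Ht. }
  assert (Hq : is_derive (fun t => marginal_ratio f' (k t)) 0 ((m - V / S) / S)).
  { apply is_derive_ext_loc with (fun t => F t / (S + t)).
    - revert Hloc. apply filter_imp. intros t (_ & Ht & _). unfold F, Rdiv.
      rewrite Rmult_assoc, Rinv_r, Rmult_1_r; [reflexivity|lra].
    - assert (E : (m - V / S) / S = (m * (S + 0) - F 0 * 1) / (S + 0) ^ 2)
        by (rewrite F0; field; lra).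
      rewrite E.
      apply (is_derive_div F (fun t => S + t)); [exact HF| |lra].
      auto_derive; [exact I|ring_R]. }
  destruct (marginal_ratio_derivative f f' (k 0)) as (g & Hg & HG); auto.
  { apply Hf. }
  exists (/ (S * g)). split.
  { apply Rinv_0_lt_compat. now apply Rmult_lt_0_compat. }
  assert (E : (m - V / S) * / (S * g) = (m - V / S) / S / g) by (field; lra).
  rewrite E.
  apply (is_derive_inverse_along (marginal_ratio f') k 0 g _ (4 * f' 1)); auto; try lra.
  revert Hloc. apply filter_imp. intros t (Hkt & _ & _).
  apply (marginal_ratio_expansive f); auto; lra.
Qed.

Theorem theorem2
  (C0 : R -> R -> R) (lam : nat -> R) (phi : nat -> R -> R)
  (f f' : R -> R) (rho rhobar : R) (kstar : nat -> R -> R)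
  (HC0 : covariance_kernel C0)
  (Hspec : positive_spectrum C0 lam phi)
  (Hf : adaptation_function f)
  (Hconvex : convex_on team_sizes f)
  (Hf' : forall k, team_sizes k -> D_in f f' team_sizes k)
  (Hf'1 : 0 < f' 1 < 1 / 2)
  (Hrhobar : capacity_threshold lam (f' 1) rhobar)
  (Hrho : 0 < rho < rhobar)
  (Hkstar : forall i, locally 0 (fun t => 0 <= lam i + t ->
     optimal_team_size (perturbed_kernel C0 (phi i) t) f rho (kstar i t))) :
  exists lambdabar : R, forall i : nat,
    (lam i < lambdabar -> exists d, is_derive (kstar i) 0 d /\ 0 < d) /\
    (lambdabar < lam i -> exists d, is_derive (kstar i) 0 d /\ d < 0) /\
    (lam i = lambdabar -> is_derive (kstar i) 0 0).
Proof.
  destruct Hrhobar as (Hrhobar & mub & nb & Wb & Hnb & Hratio).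
  pose proof (spectrum_positive _ _ _ Hspec) as Hpos.
  pose proof (spectrum_nonincreasing _ _ _ Hspec) as Hdec.
  assert (HS0 : Series lam <> 0).
  (* Division by 0 gives 0, whereas the threshold ratio is 2 f'(1) > 0. So the threshold equation
     forces a nonzero sum, and with it summability. *)
  { intros E. rewrite E in Hratio. unfold Rdiv in Hratio. rewrite Rinv_0 in Hratio. lra. }
  assert (Hex : ex_series lam)
    by (apply ex_series_of_Series_neq_0; auto using Rlt_le).
  pose proof (Series_correct _ Hex) as SS.
  assert (HS : 0 < Series lam).
  { assert (0 <= Series lam); [|lra].
    exact (is_series_le _ _ _ _ is_series_zero SS (fun j => Rlt_le _ _ (Hpos j))). }
  (* The water level and V at capacity [rho] are read off from the optimum at t = 0. Index 0 serves
     for every [i], since at t = 0 nothing is shifted; the cutoff is thereby independent of [i]. *)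
  destruct (optimal_team_size_perturbed C0 lam phi f rho (kstar 0%nat 0) 0 0 HC0 Hspec Hex)
    as (mu & V & W & SV & _ & _).
  { rewrite Rplus_0_r. apply Hpos. }
  { apply (locally_singleton _ _ (Hkstar 0%nat)). rewrite Rplus_0_r. now left. }
  assert (Hshift : forall j, shift_at lam 0 0 j = lam j).
  { intros j. unfold shift_at. destruct (Nat.eqb_spec j 0) as [->|_]; [ring|reflexivity]. }
  assert (W0 : water_level lam rho mu).
  { destruct W as [Hmu W]. split; [exact Hmu|]. revert W. apply is_series_ext.
    intros j. now rewrite Hshift. }
  assert (SV0 : is_series (fun j => Rmin mu (lam j)) V).
  { revert SV. apply is_series_ext. intros j. now rewrite Hshift. }
  clear W SV Hshift. pose proof (proj1 W0) as Hmu.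
  assert (Htop : mu < lam 0%nat)
    by (apply (water_level_below_top lam rho); auto; lra).
  assert (Hmub : mub < mu).
  { apply (water_level_decreasing lam rho rhobar); auto. lra. }
  pose proof (residual_variance_series lam mub nb Hdec Hex Hnb) as SVb.
  set (Vb := residual_variance lam mub nb) in *.
  (* Less capacity means a higher level; the top component, active at both levels, makes the
     increase of V strict. *)
  assert (HVb : Vb + (mu - mub) <= V).
  { apply (is_series_le_at _ _ _ _ (mu - mub) 0 SVb SV0).
    - intros j. apply Rle_min_compat_r. lra.
    - rewrite !Rmin_left by lra. lra. }
  assert (HVS : V + (lam 0%nat - mu) <= Series lam).
  { apply (is_series_le_at _ _ _ _ (lam 0%nat - mu) 0 SV0 SS).
    - intros j. apply Rmin_r.
    - rewrite Rmin_left by lra. lra. }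
  assert (Hgap : 2 * f' 1 < V / Series lam).
  { rewrite <- Hratio. apply Rmult_lt_compat_r; [now apply Rinv_0_lt_compat|lra]. }
  assert (HV : 0 < V).
  { assert (0 < Vb); [|lra]. replace Vb with (Vb / Series lam * Series lam) by (field; lra).
    rewrite Hratio. apply Rmult_lt_0_compat; lra. }
  assert (HV1 : V / Series lam < 1) by (apply Rcomplements.Rlt_div_l; lra).
  exists (mu * Series lam / V). intros i.
  pose proof (Hpos i) as Hi.
  destruct (optimal_team_size_derivative C0 lam phi f f' rho mu V (kstar i) i)
    as (c & Hc & Hder); auto; try lra.
  (* The uncapped difference has the sign of cutoff minus [lam i]. The cap 1 in [Rmin] leaves the
     sign unchanged because V / S < 1. *)
  assert (Hcmp : mu / lam i - V / Series lam =
    (mu * Series lam / V - lam i) * (V / (lam i * Series lam))) by (field; lra).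
  assert (Hfac : 0 < V / (lam i * Series lam))
    by (apply Rdiv_lt_0_compat; [lra|now apply Rmult_lt_0_compat]).
  split; [|split]; intros Hl.
  - eexists. split; [exact Hder|]. apply Rmult_lt_0_compat; [|exact Hc].
    assert (V / Series lam < Rmin 1 (mu / lam i)); [|lra].
    apply Rmin_glb_lt; [exact HV1|].
    assert (0 < mu / lam i - V / Series lam); [|lra].
    rewrite Hcmp. apply Rmult_lt_0_compat; lra.
  - eexists. split; [exact Hder|].
    pose proof (Rmin_r 1 (mu / lam i)).
    assert ((mu * Series lam / V - lam i) * (V / (lam i * Series lam)) < 0)
      by (apply Rmult_neg_pos; lra).
    apply Rmult_neg_pos; lra.
  - assert (E : mu / lam i = V / Series lam).
    { apply Rminus_diag_uniq. rewrite Hcmp, Hl. ring. }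
    now rewrite E, Rmin_right, Rminus_diag, Rmult_0_l in Hder by lra.
Qed.
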